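(* Let $\chi_0:\mathbb{R}^d\to\mathbb{C}^d$ be a measurable function and $T\in[0,\infty]$. Let $\mathbf{X}$ and $\bar{\mathbf{X}}$ be the non-thinned and thinned stochastic processes with initial data $\chi_0$ described in the context, and let $\underline{\mathbf{X}}(\xi,t)=\mathbf{X}(\xi,t)\mathbbm{1}_{\zeta>t}$. Then: (a) If $\mathbb{E}_\xi|\bar{\mathbf{X}}|<\infty$ a.e. on $\mathbb{R}^d\times[0,T)$, then the thinned cascade solution $\mathbb{E}_\xi\bar{\mathbf{X}}$ is equal (a.e. on $\mathbb{R}^d\times[0,T)$) to the pointwise limit of the Picard iteration $\chi^{(0)}=0$, $\chi^{(n+1)}=U(\chi_0)+\mathfrak{B}(\chi^{(n)},\chi^{(n)})$. (b) If $\mathbb{E}_\xi|\bar{\mathbf{X}}|<\infty$ a.e. on $\mathbb{R}^d\times[0,T)$, then the minimal cascade solution $\mathbb{E}_\xi\underline{\mathbf{X}}$ is equal (a.e. on $\mathbb{R}^d\times[0,T)$) to the pointwise limit of the same Picard iteration. (c) $\mathbb{E}_\xi|\bar{\mathbf{X}}|=\mathbb{E}_\xi|\underline{\mathbf{X}}|\in[0,\infty]$ a.e. in $\mathbb{R}^d\times[0,\infty)$, and therefore $\mathbb{E}_\xi\bar{\mathbf{X}}=\mathbb{E}_\xi\underline{\mathbf{X}}$ a.e. in $\mathbb{R}^d\times[0,T)$ whenever one of the expectations $\mathbb{E}_\xi|\bar{\mathbf{X}}|$, $\mathbb{E}_\xi|\underline{\mathbf{X}}|$ is finite (a.e. there)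.
   Context: Product: for $\xi\in\mathbb{R}^d\setminus\{0\}$, $e_\xi=\xi/|\xi|$, $\pi_{\xi^\perp}a=a-(e_\xi\cdot a)e_\xi$ and $a\odot_\xi b=\frac{-i}{2}\big((e_\xi\cdot b)\pi_{\xi^\perp}a+(e_\xi\cdot a)\pi_{\xi^\perp}b\big)$ for $a,b\in\mathbb{C}^d$ (with $e_\xi\cdot a=\sum_j(e_\xi)_ja_j$). Kernel: $d\ge3$, and $h:\mathbb{R}^d\setminus\{0\}\to(0,\infty)$ is a fixed standard majorizing kernel, i.e. a measurable function with $(h*h)(\xi)=|\xi|h(\xi)$ for all $\xi\ne0$. $H(\eta|\xi)=\frac{h(\eta)h(\xi-\eta)}{|\xi|h(\xi)}$, a probability density in $\eta\in\mathbb{R}^d$. Cascade: $\mathbb{T}=\{0\}\cup\bigcup_{n\ge1}\{1,2\}^n$ is the binary tree with root $0$; $|v|$ is the generation of $v$ ($|0|=0$), $v|j$ is the truncation of $v$ to generation $j$ ($v|0=0$), and $v1,v2$ are the children of $v$ (the children of the root being $1,2$). For each $\xi\ne0$, on a probability space with measure $\mathbb{P}_\xi$ (expectation $\mathbb{E}_\xi$) there are families $\{W_v\}_{v\in\mathbb{T}}$, $\{T_v\}_{v\in\mathbb{T}}$ such that: (i) $W_0=\xi$; (ii) given $W_v$, $T_v$ is exponentially distributed with mean $|W_v|^{-2}$, $W_{v1}$ is independent of $T_v$ with density $H(\cdot|W_v)$, and $W_{v2}=W_v-W_{v1}$; (iii) given $W_{v1}$ and $W_{v2}$, the sub-families (of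 $W$'s and $T$'s) indexed by the subtrees rooted at $v1$ and $v2$ are independent of each other (and are cascades started at $W_{v1}$, $W_{v2}$). There is also an i.i.d. family $\{K_v\}_{v\in\mathbb{T}}$ of Bernoulli($1/2$) variables (values $0,1$), independent of $\{W_v\}$ and $\{T_v\}$. The explosion time is $\zeta=\zeta_\xi=\sup_{n\ge0}\min_{|v|=n}\sum_{j=0}^nT_{v|j}$. Non-thinned process: $\mathbf{X}(\xi,t)=\mathbf{X}_0(t)$, where recursively $\mathbf{X}_v(s)=\chi_0(W_v)$ if $T_v\ge s$, and $\mathbf{X}_v(s)=\mathbf{X}_{v1}(s-T_v)\odot_{W_v}\mathbf{X}_{v2}(s-T_v)$ if $T_v<s$. On $[\zeta>t]$ the recursion terminates after finitely many steps, so $\mathbf{X}(\xi,t)\mathbbm{1}_{\zeta>t}$ is well defined ($0$ off $[\zeta>t]$). Thinned process: $\bar{\mathbf{X}}(\xi,t)=\bar{\mathbf{X}}_0(t)$, where $\bar{\mathbf{X}}_v(s)=\chi_0(W_v)$ if $T_v\ge s$; $\bar{\mathbf{X}}_v(s)=0$ if $T_v<s$, $K_v=0$; and $\bar{\mathbf{X}}_v(s)=2\,\bar{\mathbf{X}}_{v1}(s-T_v)\odot_{W_v}\bar{\mathbf{X}}_{v2}(s-T_v)$ if $T_v<s$, $K_v=1$. This recursion terminates a.s. (critical Galton-Watson tree). $\mathbb{E}_\xi\bar{\mathbf{X}}(\xi,t)$ and $\mathbb{E}_\xi\underline{\mathbf{X}}(\xi,t)$ are called the thinned and the minimal cascade solution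 of the normalized Fourier-transformed Navier-Stokes equation $\chi=U(\chi_0)+\mathfrak{B}(\chi,\chi)$, where $U(w)(\xi,t)=e^{-t|\xi|^2}w(\xi)$ and $$\mathfrak{B}(f,g)(\xi,t)=\int_0^te^{-s|\xi|^2}|\xi|^2\int_{\mathbb{R}^d}f(\eta,t-s)\odot_\xi g(\xi-\eta,t-s)\,H(\eta|\xi)\,d\eta\,ds .$$ *)

(* Defs.v *)
From HB Require Import structures.
From mathcomp Require Import all_boot all_order all_algebra.
From mathcomp Require Import complex.
From mathcomp Require Import all_classical all_reals all_analysis.
From mathcomp Require Import measurable_realfun.

Set Implicit Arguments.
Unset Strict Implicit.
Unset Printing Implicit Defensive.

Import Order.TTheory GRing.Theory Num.Theory.
Import numFieldNormedType.Exports.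

Local Open Scope classical_set_scope.
Local Open Scope ring_scope.
Local Open Scope complex_scope.

Section measurable_rV.
Context {dT} {T : measurableType dT}.
Variable n : nat.

Let coors : 'I_n -> 'rV[T]_n -> T := fun i v => v ord0 i.

Let rV_set0 : g_sigma_preimage coors set0.
Proof. exact: sigma_algebra0. Qed.

Let rV_setC A : g_sigma_preimage coors A -> g_sigma_preimage coors (~` A).
Proof. exact: sigma_algebraC. Qed.

Let rV_bigcup (F : (set 'rV[T]_n)^nat) :
  (forall i, g_sigma_preimage coors (F i)) ->
  g_sigma_preimage coors (\bigcup_i (F i)).
Proof. exact: sigma_algebra_bigcup. Qed.

HB.instance Definition _ := @isMeasurable.Build (measure_tuple_display dT)
  'rV[T]_n (g_sigma_preimage coors) rV_set0 rV_setC rV_bigcup.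

Lemma measurable_coord (i : 'I_n) :
  measurable_fun [set: 'rV[T]_n] (fun v => v ord0 i).
Proof.
move=> _ Y mY; rewrite setTI; apply: sub_sigma_algebra => /=.
rewrite -bigcup_seq/=; exists i => /=; first by rewrite mem_index_enum.
by exists Y => //; rewrite setTI.
Qed.

Lemma measurable_fun_rV dS (S : measurableType dS) (f : S -> 'rV[T]_n) :
  (forall i, measurable_fun [set: S] (fun x => f x ord0 i)) ->
  measurable_fun [set: S] f.
Proof.
move=> mf _ Y; rewrite setTI => mY.
pose F := [set A : set 'rV[T]_n | measurable (f @^-1` A)].
suff : F Y by [].
apply: mY; split.
- split.
  + by rewrite /F/= preimage_set0; exact: measurable0.
  + by move=> A FA; rewrite /F/= setTD preimage_setC; exact: measurableC.
  + by move=> G FG; rewrite /F/= preimage_bigcup; apply: bigcup_measurable => k _; exact: FG.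
- move=> A /=; rewrite -bigcup_seq => -[i _ [B mB <-]].
  by rewrite /F/= setTI; have := mf i measurableT B mB; rewrite setTI.
Qed.

End measurable_rV.

Section lebesgue_rV.
Context {R : realType}.

Definition rV_cons n (p : R * 'rV[R]_n) : 'rV[R]_n.+1 :=
  row_mx (p.1%:M : 'rV_1) p.2.

Definition rV_uncons n (v : 'rV[R]_n.+1) : R * 'rV[R]_n :=
  (v ord0 ord0, rsubmx (v : 'rV_(1 + n))).

Lemma rV_consK n : cancel (@rV_cons n) (@rV_uncons n).
Proof.
move=> [x v]; rewrite /rV_cons /rV_uncons row_mxKr; congr pair.
have e0 : (ord0 : 'I_(1 + n)) = lshift n (ord0 : 'I_1) by apply/val_inj.
transitivity (row_mx (x%:M : 'rV_1) v ord0 (lshift n ord0)).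
  by rewrite -e0.
by rewrite row_mxEl mxE mulr1n.
Qed.

Lemma measurable_rV_cons n : measurable_fun [set: R * 'rV[R]_n] (@rV_cons n).
Proof.
apply: measurable_fun_rV => i.
case: (split_ordP (i : 'I_(1 + n))) => j ->.
- rewrite (_ : (fun _ => _) = fst); first exact: measurable_fst.
  apply/funext => x; transitivity (x.1%:M ord0 j : R); first exact: row_mxEl.
  by rewrite mxE (ord1 j) eqxx mulr1n.
- rewrite (_ : (fun _ => _) = (fun v : 'rV[R]_n => v ord0 j) \o snd).
    by apply: measurableT_comp; [exact: measurable_coord|exact: measurable_snd].
  by apply/funext => x; exact: row_mxEr.
Qed.

Lemma measurable_rV_uncons n : measurable_fun [set: 'rV[R]_n.+1] (@rV_uncons n).
Proof.
apply: measurable_fun_pair; first exact: measurable_coord.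
apply: measurable_fun_rV => i.
rewrite (_ : (fun _ => _) = (fun v : 'rV[R]_n.+1 => v ord0 (rshift 1 i))).
  exact: measurable_coord.
by apply/funext => v; rewrite mxE.
Qed.

Section lebesgue_rVS.
Variables (n : nat) (mu : {sigma_finite_measure set 'rV[R]_n -> \bar R}).

Definition lebesgue_rVS : set 'rV[R]_n.+1 -> \bar R :=
  pushforward (@lebesgue_measure R \x mu)%E (@rV_cons n).

Let lebesgue_rVS0 : lebesgue_rVS set0 = 0%E.
Proof. by rewrite /lebesgue_rVS /pushforward preimage_set0 measure0. Qed.

Let lebesgue_rVS_ge0 A : (0 <= lebesgue_rVS A)%E.
Proof. by rewrite /lebesgue_rVS /pushforward measure_ge0. Qed.

Let lebesgue_rVS_sigma_additive : semi_sigma_additive lebesgue_rVS.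
Proof.
move=> F mF tF mUF; rewrite /lebesgue_rVS /pushforward preimage_bigcup.
have mcons (A : set 'rV[R]_n.+1) : measurable A -> measurable (@rV_cons n @^-1` A).
  by move=> mA; rewrite -[X in measurable X]setTI; exact: measurable_rV_cons.
apply: measure_semi_sigma_additive.
- by move=> k; exact: mcons.
- apply/trivIsetP => /= i j _ _ ij; rewrite -preimage_setI.
  by move/trivIsetP : tF => /(_ _ _ _ _ ij) ->//; rewrite preimage_set0.
- by rewrite -preimage_bigcup; exact: mcons.
Qed.

HB.instance Definition _ := isMeasure.Build _ _ _ lebesgue_rVS
  lebesgue_rVS0 lebesgue_rVS_ge0 lebesgue_rVS_sigma_additive.

Let lebesgue_rVS_sigma_finite : sigma_finite setT lebesgue_rVS.
Proof.
have /sigma_finiteP[F [TF ndF Foo]] := sigma_finiteT (@lebesgue_measure R).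
have /sigma_finiteP[G [TG ndG Goo]] := sigma_finiteT mu.
exists (fun k => @rV_uncons n @^-1` (F k `*` G k)).
  rewrite -preimage_bigcup (_ : \bigcup_k _ = setT) ?preimage_setT//.
  rewrite -[RHS]setXTT TF TG predeqE => -[x y]; split.
    by move=> [k _ []/= ? ?]; split; exists k.
  move=> [/= [k _ Fkx] [l _ Gly]]; exists (maxn k l) => //; split.
  - by move: x Fkx; exact/subsetPset/ndF/leq_maxl.
  - by move: y Gly; exact/subsetPset/ndG/leq_maxr.
move=> k; have [mF Fkoo] := Foo k; have [mG Gkoo] := Goo k; split.
  rewrite -[X in measurable X]setTI; apply: measurable_rV_uncons => //.
  exact: measurableX.
rewrite /lebesgue_rVS /pushforward -comp_preimage.
rewrite (_ : _ \o _ = id); last by apply/funext => p /=; rewrite rV_consK.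
by rewrite preimage_id product_measure1E// lte_mul_pinfty// ge0_fin_numE.
Qed.

HB.instance Definition _ := Measure_isSigmaFinite.Build _ _ _ lebesgue_rVS
  lebesgue_rVS_sigma_finite.

End lebesgue_rVS.

(* Lebesgue measure on R^n is built one coordinate at a time, as the image of
   the product measure under (x, v) |-> row_mx x v; on R^0 it is the unit mass
   at the only point. *)
Fixpoint lebesgue_rV n : {sigma_finite_measure set 'rV[R]_n -> \bar R} :=
  if n is n'.+1 then lebesgue_rVS (lebesgue_rV n')
  else @dirac _ 'rV[R]_0 (0 : 'rV[R]_0) R.

Lemma measurable_box n (A : 'I_n -> set R) : (forall i, measurable (A i)) ->
  measurable [set v : 'rV[R]_n | forall i, A i (v ord0 i)].
Proof.
move=> mA.
rewrite (_ : [set _ | _] = \bigcap_i (fun v : 'rV[R]_n => v ord0 i) @^-1` A i).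
  apply: fin_bigcap_measurable => [|i _]; first exact: finite_finset.
  by rewrite -[X in measurable X]setTI; exact: measurable_coord.
by apply/seteqP; split => v /= Av i; [move=> _|]; exact: Av.
Qed.

Lemma lebesgue_rV_box n (A : 'I_n -> set R) : (forall i, measurable (A i)) ->
  (lebesgue_rV n [set v | forall i, A i (v ord0 i)] =
   \prod_(i < n) lebesgue_measure (A i))%E.
Proof.
elim: n A => [A _|n IH A mA].
  rewrite big_ord0 /= diracE (_ : _ \in _)//.
  by rewrite inE /= => -[].
rewrite big_ord_recl -IH => [|i]; last exact: mA.
rewrite -product_measure1E; last 2 first.
- exact: mA.
- exact: (@measurable_box n (fun i => A (lift ord0 i))).
rewrite /= /lebesgue_rVS /pushforward; congr (_ _).
have consl x (v : 'rV[R]_n) : rV_cons (x, v) ord0 ord0 = x.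
  exact: (congr1 fst (rV_consK (x, v))).
have consr x (v : 'rV[R]_n) i : rV_cons (x, v) ord0 (lift ord0 i) = v ord0 i.
  transitivity (rV_cons (x, v) ord0 (rshift 1 i)); last exact: row_mxEr.
  by congr (rV_cons _ _ _); exact/val_inj.
apply/seteqP; split => -[x v] /=.
  by move=> Av; split=> [|i]; [rewrite -(consl x v)|rewrite -(consr x v)].
move=> [Ax Av] i; case: (unliftP ord0 i) => [j|] ->.
  by rewrite consr; exact: Av.
by rewrite consl.
Qed.

End lebesgue_rV.

Section navier_stokes.
Context {R : realType} {d : nat}.
Local Notation Vec := 'rV[R]_d.
Local Notation Cvec := 'rV[R[i]]_d.

Definition enorm (x : Vec) : R := Num.sqrt (\sum_j x ord0 j ^+ 2).

Definition cnorm (a : Cvec) : R :=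
  Num.sqrt (\sum_j (complex.Re (a ord0 j) ^+ 2 + complex.Im (a ord0 j) ^+ 2)).

Definition direction (xi : Vec) : Cvec := \row_j (xi ord0 j / enorm xi)%:C.

(* bilinear: no complex conjugation *)
Definition cdot (a b : Cvec) : R[i] := \sum_j a ord0 j * b ord0 j.

Definition perp_proj (xi : Vec) (a : Cvec) : Cvec :=
  a - cdot (direction xi) a *: direction xi.

Definition odot (xi : Vec) (a b : Cvec) : Cvec :=
  (- 'i%C / 2) *: (cdot (direction xi) b *: perp_proj xi a +
                   cdot (direction xi) a *: perp_proj xi b).

Definition measurable_cvec_fun (f : Vec -> Cvec) : Prop := forall j,
  measurable_fun [set: Vec] (fun x => complex.Re (f x ord0 j)) /\
  measurable_fun [set: Vec] (fun x => complex.Im (f x ord0 j)).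

(* Coordinatewise. Rintegral is total: it is 0 when the extended-real integral is
   infinite. *)
Definition cvec_integral dS (S : measurableType dS)
    (mu : {measure set S -> \bar R}) (D : set S) (f : S -> Cvec) : Cvec :=
  \row_j ((\int[mu]_(x in D) complex.Re (f x ord0 j)) +i*
          (\int[mu]_(x in D) complex.Im (f x ord0 j))).

(* h lives on R^d \ {0}; its value at 0 is arbitrary, and the integrand of the
   convolution involves it only at the two points eta = 0 and eta = xi. *)
Record majorizing_kernel (h : Vec -> R) : Prop := MajorizingKernel {
  majorizing_measurable : measurable_fun (~` [set (0 : Vec)]) h ;
  majorizing_gt0 : forall xi : Vec, xi != 0 -> 0 < h xi ;
  majorizing_conv : forall xi : Vec, xi != 0 ->
    (\int[lebesgue_rV d]_eta (h eta * h (xi - eta))%:E = (enorm xi * h xi)%:E)%E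
}.

Definition branching_density (h : Vec -> R) (eta xi : Vec) : R :=
  h eta * h (xi - eta) / (enorm xi * h xi).

Definition heat_flow (w : Vec -> Cvec) (xi : Vec) (t : R) : Cvec :=
  (expR (- t * enorm xi ^+ 2))%:C *: w xi.

Definition duhamel (h : Vec -> R) (f g : Vec -> R -> Cvec)
    (xi : Vec) (t : R) : Cvec :=
  cvec_integral (@lebesgue_measure R) `[0, t] (fun s =>
    (expR (- s * enorm xi ^+ 2) * enorm xi ^+ 2)%:C *:
    cvec_integral (lebesgue_rV d) setT (fun eta =>
      (branching_density h eta xi)%:C *:
      odot xi (f eta (t - s)) (g (xi - eta) (t - s)))).

Fixpoint picard (h : Vec -> R) (chi0 : Vec -> Cvec) (n : nat)
    (xi : Vec) (t : R) : Cvec :=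
  if n is m.+1
  then heat_flow chi0 xi t + duhamel h (picard h chi0 m) (picard h chi0 m) xi t
  else 0.

Definition ae_before (Tmax : \bar R) (Q : Vec -> R -> Prop) : Prop :=
  {ae (lebesgue_rV d \x @lebesgue_measure R)%E, forall p : Vec * R,
    (0 <= p.2)%R -> (p.2%:E < Tmax)%E -> Q p.1 p.2}.

(* A vertex is the word of its successive branchings, false for the first child
   and true for the second; the root is the empty word. *)
Definition vertex := seq bool.

Definition child1 (v : vertex) : vertex := rcons v false.
Definition child2 (v : vertex) : vertex := rcons v true.

Definition explosion_time (tau : vertex -> R) : \bar R :=
  ereal_sup (range (fun n : nat =>
    \big[Order.min/+oo%E]_(v : n.-tuple bool)
      (\sum_(0 <= j < n.+1) tau (take j v))%:E)).

(* nonthinned_value w tau v s a: the recursion for X_v(s) terminates with value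
   a. Being inductive, it has no derivation when the recursion does not
   terminate. *)
Inductive nonthinned_value (chi0 : Vec -> Cvec)
    (w : vertex -> Vec) (tau : vertex -> R) : vertex -> R -> Cvec -> Prop :=
| NonthinnedStop v s of s <= tau v :
    nonthinned_value chi0 w tau v s (chi0 (w v))
| NonthinnedBranch v s a b of tau v < s
    & nonthinned_value chi0 w tau (child1 v) (s - tau v) a
    & nonthinned_value chi0 w tau (child2 v) (s - tau v) b :
    nonthinned_value chi0 w tau v s (odot (w v) a b).

Inductive thinned_value (chi0 : Vec -> Cvec) (w : vertex -> Vec)
    (tau : vertex -> R) (kappa : vertex -> bool) :
    vertex -> R -> Cvec -> Prop :=
| ThinnedStop v s of s <= tau v :
    thinned_value chi0 w tau kappa v s (chi0 (w v))
| ThinnedKill v s of tau v < s & ~~ kappa v :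
    thinned_value chi0 w tau kappa v s 0
| ThinnedBranch v s a b of tau v < s & kappa v
    & thinned_value chi0 w tau kappa (child1 v) (s - tau v) a
    & thinned_value chi0 w tau kappa (child2 v) (s - tau v) b :
    thinned_value chi0 w tau kappa v s (2 *: odot (w v) a b).

Definition minimal_process (chi0 : Vec -> Cvec) (w : vertex -> Vec)
    (tau : vertex -> R) (t : R) : Cvec :=
  if (t%:E < explosion_time tau)%E
  then xget 0 [set a | nonthinned_value chi0 w tau [::] t a] else 0.

(* 0 on the null event where the recursion does not terminate *)
Definition thinned_process (chi0 : Vec -> Cvec) (w : vertex -> Vec)
    (tau : vertex -> R) (kappa : vertex -> bool) (t : R) : Cvec :=
  xget 0 [set a | thinned_value chi0 w tau kappa [::] t a].

End navier_stokes.

(* the product sigma-algebra on families indexed by I *)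
Definition family_events (I : Type) dS (S : measurableType dS) :
    set (set (I -> S)) :=
  <<s [set E | exists i (B : set S), measurable B /\ E = [set f | B (f i)] ] >>.
Arguments family_events : clear implicits.

Section cascade.
Context {R : realType} {d : nat}.
Local Notation Vec := 'rV[R]_d.
Local Notation branch_events := (family_events vertex _ (Vec * R)%type).
Variables (h : Vec -> R) (dO : measure_display) (O : Vec -> measurableType dO).
Variable P : forall xi, probability (O xi) R.
Variables (W : forall xi, vertex -> O xi -> Vec)
  (T : forall xi, vertex -> O xi -> R) (K : forall xi, vertex -> O xi -> bool).

Definition branch xi (v : vertex) (omega : O xi) : vertex -> Vec * R :=
  fun u => (W (v ++ u) omega, T (v ++ u) omega).

Definition cascade_law xi (E : set (vertex -> Vec * R)) : \bar R :=
  P xi [set omega | E (branch [::] omega)].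

(* A conditional law is expressed by its integrals over the events of the
   conditioning variables. As W_v2 = W_v - W_v1 and W_0 = xi are identities of
   random variables, they are only required almost surely. The measures P 0 and
   cascade_law 0 are arbitrary: started at xi != 0, almost surely no W_v is 0. *)
Record cascade : Prop := Cascade {
  cascade_measurable_W : forall xi : Vec, xi != 0 -> forall v,
    measurable_fun [set: O xi] (W v) ;
  cascade_measurable_T : forall xi : Vec, xi != 0 -> forall v,
    measurable_fun [set: O xi] (T v) ;
  cascade_measurable_K : forall xi : Vec, xi != 0 -> forall v,
    measurable_fun [set: O xi] (K v) ;
  cascade_root : forall xi : Vec, xi != 0 ->
    {ae P xi, forall omega, W [::] omega = xi} ;
  (* given W_v, the variables T_v and W_v1 are independent, T_v is exponential
     with mean |W_v|^-2 and W_v1 has density H(.|W_v) *)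
  cascade_offspring : forall xi : Vec, xi != 0 ->
    forall (v : vertex) (A C : set Vec) (B : set R),
    measurable A -> measurable B -> measurable C ->
    P xi [set omega | A (W v omega) /\ B (T v omega) /\ C (W (child1 v) omega)]
    = (\int[P xi]_(omega in [set omega | A (W v omega)])
         (exponential_prob (enorm (W v omega) ^+ 2) B *
          \int[lebesgue_rV d]_(eta in C)
            (branching_density h eta (W v omega))%:E))%E ;
  cascade_conservation : forall xi : Vec, xi != 0 -> forall v,
    {ae P xi, forall omega, W (child2 v) omega = W v omega - W (child1 v) omega} ;
  cascade_law_measurable : forall E, branch_events E ->
    measurable_fun (~` [set (0 : Vec)]) (fun xi : Vec => cascade_law xi E) ;
  (* given W_v1 and W_v2, the time T_v and the branches rooted at v1 and v2 are
     independent, and these branches are cascades started at W_v1 and W_v2 *)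
  cascade_branching : forall xi : Vec, xi != 0 ->
    forall (v : vertex) (B : set R) (G : set (Vec * Vec))
           (E1 E2 : set (vertex -> Vec * R)),
    measurable B -> measurable G -> branch_events E1 -> branch_events E2 ->
    let F := [set omega : O xi |
      B (T v omega) /\ G (W (child1 v) omega, W (child2 v) omega)] in
    P xi (F `&` [set omega |
      E1 (branch (child1 v) omega) /\ E2 (branch (child2 v) omega)])
    = (\int[P xi]_(omega in F)
         (cascade_law (W (child1 v) omega) E1 *
          cascade_law (W (child2 v) omega) E2))%E ;
  cascade_bernoulli : forall xi : Vec, xi != 0 -> forall v b,
    P xi [set omega | K v omega = b] = (2^-1)%:E ;
  cascade_thinning_independent : forall xi : Vec, xi != 0 ->
    forall (s : seq vertex) (b : vertex -> bool), uniq s ->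
    P xi [set omega | forall v, v \in s -> K v omega = b v]
    = (\prod_(v <- s) P xi [set omega | K v omega = b v])%E ;
  cascade_thinning_independent_of_branching : forall xi : Vec, xi != 0 ->
    forall (E : set (vertex -> Vec * R)) (E' : set (vertex -> bool)),
    branch_events E -> family_events vertex _ bool E' ->
    P xi ([set omega | E (branch [::] omega)] `&`
          [set omega | E' (fun v => K v omega)])
    = (P xi [set omega | E (branch [::] omega)] *
       P xi [set omega | E' (fun v => K v omega)])%E
}.

End cascade.

Section cascade_solutions.
Context {R : realType} {d : nat}.
Local Notation Vec := 'rV[R]_d.
Local Notation Cvec := 'rV[R[i]]_d.
Variables (dO : measure_display) (O : Vec -> measurableType dO).
Variable P : forall xi, probability (O xi) R.

Definition mean (X : forall xi, R -> O xi -> Cvec) (xi : Vec) (t : R) : Cvec :=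
  cvec_integral (P xi) setT (X xi t).

Definition mean_norm (X : forall xi, R -> O xi -> Cvec) (xi : Vec) (t : R) :
    \bar R :=
  (\int[P xi]_omega (cnorm (X xi t omega))%:E)%E.

Variables (W : forall xi, vertex -> O xi -> Vec)
  (T : forall xi, vertex -> O xi -> R) (K : forall xi, vertex -> O xi -> bool).

Definition minimal_cascade (chi0 : Vec -> Cvec) xi (t : R) (omega : O xi) :=
  minimal_process chi0 (fun v => W v omega) (fun v => T v omega) t.

Definition thinned_cascade (chi0 : Vec -> Cvec) xi (t : R) (omega : O xi) :=
  thinned_process chi0 (fun v => W v omega) (fun v => T v omega)
    (fun v => K v omega) t.

End cascade_solutions.

(* Main.v *)
From HB Require Import structures.
Require Import Defs.
From mathcomp Require Import all_boot all_order all_algebra.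
From mathcomp Require Import complex.
From mathcomp Require Import all_classical all_reals all_analysis.
From mathcomp Require Import measurable_realfun.
From mathcomp Require Import ring lra.

Import Order.TTheory GRing.Theory Num.Theory.
Import numFieldNormedType.Exports.

(** The recursion that defines X can be cut off at depth n: a subtree that has not
    stopped before generation n receives the value 0 ([truncated]). As the product
    is bilinear, one unfinished subtree makes the whole cut-off value 0
    ([truncated_eq0]); hence the cut-off is either 0 or already the value of X.
    Almost surely all times are positive, and then the recursion terminates exactly
    on the event zeta > t ([lt_explosion_time]), so that the cut-off values are
    eventually equal to the minimal process.

    Thinned against minimal. When the non-thinned recursion terminates with N
    branching vertices, the thinned value is the non-thinned one times 2^N if the N
    coins are all favourable, and 0 otherwise. When it does not terminate, both
    values are 0, because the thinned recursion can then stop only by killing a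
    vertex. The coins are independent of the positions and times, so the factor has
    conditional mean 1, and the two processes give the same mean to every
    nonnegative positively homogeneous function ([thinned_minimal_integral]). The
    norm gives the equality of the E|X|, the positive and negative parts of the
    coordinates give the equality of the means, for every xi <> 0 and every t.

    Picard iteration. Let chi_n(xi,t) be the mean of the cut-off at depth n. The
    first branching time and the position of the first child have density
    |xi|^2 exp(-s|xi|^2) H(eta|xi), and given them the two subtrees are independent
    cascades ([first_branching_integral]). Taking means in the recursion gives
    chi_(n+1) = U(chi0) + B(chi_n, chi_n), provided that the mean of the product of
    the two subtrees is the product of their means ([picard_step]). This is where
    the integrability hypothesis enters, and it has to be used almost everywhere:
    |a . b| may be much smaller than |a||b|, so that a finite E|X| at (xi,t) does
    not bound the mean of |X_1||X_2|. But null sets are invariant under the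
    reflections s -> t - s and eta -> xi - eta, so for almost every (s,eta) both
    subtrees have a finite mean norm, and Fubini applies to their product. The outer
    integral over (s,eta) converges absolutely because it is the conditional mean of
    an integrable variable. So chi_n is the n-th Picard iterate wherever E|X| is
    finite ([picard_truncated_mean]), and dominated convergence, with |X| as the
    bound, finishes the proof ([picard_cvg]).

    Two devices keep the measure theory short. Iterated integrals are treated as
    countably additive functionals of the integrand, and such functionals are equal
    as soon as they agree on rectangles ([eq_functional_prod3]). The Picard iterates
    are only known to be equal almost everywhere to measurable functions, which is
    enough to compute their integrals ([ae_eq_integral_nonmeasurable]). *)

Set Implicit Arguments.
Unset Strict Implicit.
Unset Printing Implicit Defensive.

Local Open Scope classical_set_scope.
Local Open Scope ring_scope.

(** * Recursions and their cut-off at finite depth *)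

Section deterministic.
Context {R : realType} {d : nat}.
Local Notation Vec := 'rV[R]_d.
Local Notation Cvec := 'rV[R[i]]_d.
Local Notation Fam := (vertex -> Vec * R).
Implicit Types (x : Fam) (s : R) (v : vertex).

Lemma odotZZ (xi : Vec) (k l : R[i]) (a b : Cvec) :
  odot xi (k *: a) (l *: b) = (k * l) *: odot xi a b.
Proof.
have cdotZ u z : cdot (direction xi) (u *: z) = u * cdot (direction xi) z.
  by rewrite /cdot mulr_sumr; apply: eq_bigr => j _; rewrite !mxE mulrCA.
rewrite /odot /perp_proj !cdotZ.
apply/rowP => j; rewrite !mxE; ring.
Qed.

Lemma odotDl (xi : Vec) (a a' b : Cvec) :
  odot xi (a + a') b = odot xi a b + odot xi a' b.
Proof.
have cdotD u z : cdot (direction xi) (u + z) =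
    cdot (direction xi) u + cdot (direction xi) z.
  by rewrite /cdot -big_split; apply: eq_bigr => j _; rewrite !mxE mulrDr.
by rewrite /odot /perp_proj !cdotD; apply/rowP => j; rewrite !mxE; ring.
Qed.

Lemma odotC (xi : Vec) (a b : Cvec) : odot xi a b = odot xi b a.
Proof. by rewrite /odot addrC. Qed.

Lemma odotDr (xi : Vec) (a b b' : Cvec) :
  odot xi a (b + b') = odot xi a b + odot xi a b'.
Proof. by rewrite odotC odotDl !(odotC xi a). Qed.

Lemma odotZl (xi : Vec) (k : R[i]) (a b : Cvec) :
  odot xi (k *: a) b = k *: odot xi a b.
Proof. by rewrite -[b]scale1r odotZZ mulr1 scale1r. Qed.

Lemma odotZr (xi : Vec) (k : R[i]) (a b : Cvec) :
  odot xi a (k *: b) = k *: odot xi a b.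
Proof. by rewrite odotC odotZl odotC. Qed.

Lemma odot0l (xi : Vec) (b : Cvec) : odot xi 0 b = 0.
Proof. by rewrite -[0](scale0r 0) odotZl !scale0r. Qed.

Lemma odot0r (xi : Vec) (a : Cvec) : odot xi a 0 = 0.
Proof. by rewrite odotC odot0l. Qed.

(** Families are indexed by the words relative to their own root, so that the
    recursions below only see one family and passing to a child is a shift. *)
Definition subfamily (b : bool) x : Fam := fun u => x (b :: u).

Fixpoint stops n x s : bool :=
  if n is m.+1 then
    (s <= (x [::]).2) ||
    (stops m (subfamily false x) (s - (x [::]).2) &&
     stops m (subfamily true x) (s - (x [::]).2))
  else false.

Fixpoint branching_nodes n x s : seq vertex :=
  if n is m.+1 then
    if s <= (x [::]).2 then [::] else
    [::] :: map (cons false) (branching_nodes m (subfamily false x) (s - (x [::]).2))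
         ++ map (cons true) (branching_nodes m (subfamily true x) (s - (x [::]).2))
  else [::].

Lemma branching_nodes_uniq n x s : uniq (branching_nodes n x s).
Proof.
elim: n x s => //= n IH x s; case: ifP => //= _.
rewrite mem_cat negb_or cat_uniq !map_inj_uniq ?IH; try by move=> ? ? [].
rewrite !andbT /=; apply/andP; split.
  by apply/andP; split; apply/mapP => -[].
by apply/hasPn => _ /mapP[u _ ->]; apply/mapP => -[].
Qed.

Variable chi0 : Vec -> Cvec.

Fixpoint truncated n x s : Cvec :=
  if n is m.+1 then
    if s <= (x [::]).2 then chi0 (x [::]).1 else
    odot (x [::]).1 (truncated m (subfamily false x) (s - (x [::]).2))
                    (truncated m (subfamily true x) (s - (x [::]).2))
  else 0.

(** Some branch is still running at depth n and contributes the factor 0. *)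
Lemma truncated_eq0 n x s : ~~ stops n x s -> truncated n x s = 0.
Proof.
elim: n x s => //= n IH x s; case: ifP => //= _.
by rewrite negb_and => /orP[] /IH ->; rewrite ?odot0l ?odot0r.
Qed.

Lemma stops_stable m n x s : (m <= n)%N -> stops m x s ->
  [/\ stops n x s, truncated n x s = truncated m x s
    & branching_nodes n x s = branching_nodes m x s].
Proof.
elim: m n x s => // m IH [//|n] x s; rewrite ltnS => mn /=.
by case: ifP => //= _ /andP[] /(IH _ _ _ mn)[-> -> ->] /(IH _ _ _ mn)[-> -> ->].
Qed.

Lemma stops_unique m n x s : stops m x s -> stops n x s ->
  truncated n x s = truncated m x s.
Proof.
have [mn|/ltnW nm] := leqP m n; first by move=> /(stops_stable mn)[].
by move=> _ /(stops_stable nm)[].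
Qed.

Definition rooted_family (w : vertex -> Vec) (tau : vertex -> R) v : Fam :=
  fun u => (w (v ++ u), tau (v ++ u)).

Lemma subfamily_rooted w tau v b :
  subfamily b (rooted_family w tau v) = rooted_family w tau (rcons v b).
Proof. by apply/funext => u; rewrite /subfamily /rooted_family cat_rcons. Qed.

Variables (w : vertex -> Vec) (tau : vertex -> R).
Local Notation fam := (rooted_family w tau).

Lemma nonthinned_value_truncated n v s : stops n (fam v) s ->
  nonthinned_value chi0 w tau v s (truncated n (fam v) s).
Proof.
elim: n v s => //= n IH v s; rewrite !cats0 !subfamily_rooted.
case: ifPn => [sv _|]; first exact: NonthinnedStop.
rewrite -ltNge => vs /= /andP[/IH H1 /IH H2].
exact: NonthinnedBranch.
Qed.

Lemma nonthinned_value_inv v s a : nonthinned_value chi0 w tau v s a ->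
  exists2 n, stops n (fam v) s & a = truncated n (fam v) s.
Proof.
elim=> {v s a} [v s sv|v s a b vs _ [m Hm ->] _ [n Hn ->]].
  by exists 1%N => /=; rewrite !cats0 sv.
have [Sm Em _] := stops_stable (leq_maxl m n) Hm.
have [Sn En _] := stops_stable (leq_maxr m n) Hn.
exists (maxn m n).+1 => /=; rewrite !cats0 !subfamily_rooted leNgt vs /=.
  by rewrite Sm Sn.
by rewrite Em En.
Qed.

Variable kappa : vertex -> bool.

Definition thinning_weight v (l : seq vertex) : R[i] :=
  if all (fun u => kappa (v ++ u)) l then 2 ^+ size l else 0.

Lemma thinning_weight_node v l1 l2 :
  thinning_weight v ([::] :: map (cons false) l1 ++ map (cons true) l2) =
  if kappa v then 2 * (thinning_weight (child1 v) l1 * thinning_weight (child2 v) l2)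
  else 0.
Proof.
rewrite /thinning_weight /= cats0 all_cat !all_map.
case: (kappa v) => //=.
have E b l : all (preim [eta cons b] (fun u => kappa (v ++ u))) l =
    all (fun u => kappa (rcons v b ++ u)) l.
  by apply: eq_all => u /=; rewrite cat_rcons.
rewrite !E size_cat !size_map /child1 /child2.
case: (all _ l1); case: (all _ l2); rewrite ?mul0r ?mulr0//=.
by rewrite exprS exprD.
Qed.

Lemma thinned_value_truncated n v s : stops n (fam v) s ->
  thinned_value chi0 w tau kappa v s
    (thinning_weight v (branching_nodes n (fam v) s) *: truncated n (fam v) s).
Proof.
elim: n v s => //= n IH v s; rewrite !cats0 !subfamily_rooted.
case: ifPn => [sv _|].
  by rewrite /thinning_weight /= scale1r; exact: ThinnedStop.
rewrite -ltNge => vs /= /andP[/IH H1 /IH H2].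
rewrite thinning_weight_node; case: ifPn => kv; last first.
  by rewrite scale0r; exact: ThinnedKill.
rewrite -scalerA -odotZZ.
exact: ThinnedBranch.
Qed.

(** Second part: some branch of the non-thinned recursion runs forever, so the
    thinned recursion has killed a vertex on it, and that 0 propagates to the root. *)
Lemma thinned_value_inv v s a : thinned_value chi0 w tau kappa v s a ->
  (forall n, stops n (fam v) s -> a =
     thinning_weight v (branching_nodes n (fam v) s) *: truncated n (fam v) s) /\
  ((forall n, ~~ stops n (fam v) s) -> a = 0).
Proof.
elim=> {v s a} [v s sv|v s vs kv|v s a b vs kv _ [H1 N1] _ [H2 N2]].
- split=> [[//|n] _|/(_ 1%N)] /=; rewrite !cats0 sv //.
  by rewrite /thinning_weight /= scale1r.
- split=> [[//|n]|//] /=; rewrite !cats0 leNgt vs /= => _.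
  by rewrite thinning_weight_node (negbTE kv) scale0r.
- split=> [[//|n]|/= Nn] /=.
    rewrite !cats0 leNgt vs !subfamily_rooted /= => /andP[/H1 -> /H2 ->].
    by rewrite thinning_weight_node kv -scalerA odotZZ.
  have [[m Hm]|/forallNP Nm] := pselect (exists n, stops n (fam (child1 v)) (s - tau v)).
    have [[k Hk]|/forallNP Nk] := pselect (exists n, stops n (fam (child2 v)) (s - tau v)).
      have [Sm _ _] := stops_stable (leq_maxl m k) Hm.
      have [Sk _ _] := stops_stable (leq_maxr m k) Hk.
      have := Nn (maxn m k).+1; rewrite /= !cats0 !subfamily_rooted.
      by rewrite Sm Sk orbT.
    rewrite N2 ?odot0r ?scaler0// => k; exact/negP.
  rewrite N1 ?odot0l ?scaler0// => k; exact/negP.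
Qed.

Lemma thinned_process_stops n t : stops n (fam [::]) t ->
  thinned_process chi0 w tau kappa t =
  thinning_weight [::] (branching_nodes n (fam [::]) t) *: truncated n (fam [::]) t.
Proof.
move=> Hn; rewrite /thinned_process; case: xgetP => [a _ /= /thinned_value_inv[/(_ _ Hn)]//|].
by move=> /(_ _ (thinned_value_truncated Hn)).
Qed.

Lemma thinned_process_nonstop t : (forall n, ~~ stops n (fam [::]) t) ->
  thinned_process chi0 w tau kappa t = 0.
Proof.
move=> Hn; rewrite /thinned_process; case: xgetP => [a _ /= /thinned_value_inv[_]|//].
exact.
Qed.

End deterministic.

(** * Termination and explosion *)

Section explosion.
Context {R : realType} {d : nat}.
Local Notation Vec := 'rV[R]_d.
Local Notation Cvec := 'rV[R[i]]_d.
Local Notation Fam := (vertex -> Vec * R).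
Implicit Types (x : Fam) (s : R) (v : vertex).

Definition path_time n x v : R := \sum_(0 <= j < n.+1) (x (take j v)).2.

Lemma path_time_cons n x b v :
  path_time n.+1 x (b :: v) = (x [::]).2 + path_time n (subfamily b x) v.
Proof. by rewrite /path_time big_nat_recl. Qed.

Lemma stops_of_path_time n x s :
  (forall v, size v = n -> s < path_time n x v) -> stops n.+1 x s.
Proof.
elim: n x s => [|n IH] x s H.
  by have := H [::] erefl; rewrite /path_time big_nat1 /= => /ltW ->.
rewrite [stops _ _ _]/=; apply/orP; right.
by apply/andP; split; apply: IH => v vn; rewrite ltrBlDl -path_time_cons;
  apply: H; rewrite /= vn.
Qed.

(** A stopping vertex only gives a weak inequality, and its generation is less than
    n; the positive time of the next generation makes the inequality strict. *)
Lemma path_time_of_stops n x s : (forall v, 0 < (x v).2) -> stops n x s ->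
  forall v, size v = n -> s < path_time n x v.
Proof.
elim: n x s => // n IH x s x0 /=.
have pt0 m y u : (forall v, 0 < (y v).2) -> 0 < path_time m y u.
  move=> y0; rewrite /path_time big_nat_recr //=; apply: ltr_wpDl => //.
  by apply: sumr_ge0 => i _; exact/ltW.
move=> H [//|b v] [vn]; rewrite path_time_cons.
case/orP: H => [sx|/andP[H1 H2]].
  by rewrite (le_lt_trans sx)// ltrDl pt0 // => u; exact: x0.
rewrite -ltrBlDl; case: b; apply: IH => // u; exact: x0.
Qed.

Variable chi0 : Vec -> Cvec.
Variables (w : vertex -> Vec) (tau : vertex -> R).
Local Notation fam := (rooted_family w tau [::]).

Lemma lt_explosion_time t : (forall v, 0 < tau v) ->
  (t%:E < explosion_time tau)%E <-> exists n, stops n fam t.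
Proof.
move=> tau0; split.
  move=> /ereal_sup_gt[_ [n _ <-]] /bigmin_gtP[_ H]; exists n.+1.
  apply: stops_of_path_time => v /eqP vn.
  by have := H (Tuple vn) isT; rewrite lte_fin.
move=> [n Hn]; apply: (@lt_le_trans _ _ (\big[Order.min/+oo%E]_(v : n.-tuple bool)
      (\sum_(0 <= j < n.+1) tau (take j v))%:E)); last first.
  by apply: ereal_sup_ubound; exists n.
apply/bigmin_gtP; split=> [|v _]; first exact: ltry.
by rewrite lte_fin; apply: (path_time_of_stops _ Hn); rewrite ?size_tuple // => u.
Qed.

Lemma minimal_process_stops n t : (forall v, 0 < tau v) -> stops n fam t ->
  minimal_process chi0 w tau t = truncated chi0 n fam t.
Proof.
move=> tau0 Hn; rewrite /minimal_process ifT; last first.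
  by apply/(lt_explosion_time _ tau0); exists n.
case: xgetP => [a _ /= /nonthinned_value_inv[m Hm ->]|].
  exact: stops_unique.
by move=> /(_ _ (nonthinned_value_truncated chi0 Hn)).
Qed.

Lemma minimal_process_nonstop t : (forall v, 0 < tau v) ->
  (forall n, ~~ stops n fam t) -> minimal_process chi0 w tau t = 0.
Proof.
move=> tau0 Hn; rewrite /minimal_process; case: ifPn => // /(lt_explosion_time _ tau0)[n].
by rewrite (negbTE (Hn n)).
Qed.

End explosion.

(** * Integration functionals *)

Section ae_integral.
Local Open Scope ereal_scope.
Context dT (S : measurableType dT) (R : realType).
Variable mu : {measure set S -> \bar R}.

Import HBNNSimple.

Lemma le_integral_ae_ge0 (D : set S) (f g : S -> \bar R) :
  measurable D ->
  (forall x, D x -> 0 <= f x) -> (forall x, D x -> 0 <= g x) ->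
  {ae mu, forall x, D x -> f x <= g x} ->
  \int[mu]_(x in D) f x <= \int[mu]_(x in D) g x.
Proof.
move=> mD f0 g0 [N [mN muN0 HN]].
rewrite [leLHS]integral_mkcond [leRHS]integral_mkcond.
have pos k : (forall x, D x -> 0 <= k x) -> forall x, 0 <= (k \_ D) x.
  by move=> k0 x; rewrite patchE; case: ifPn => //; rewrite inE => /k0.
rewrite [leLHS]ge0_integralTE; last exact: pos.
apply: ge_ereal_sup => _ [h /= hf <-].
have mNC : measurable (~` N) by exact: measurableC.
pose h' := [the {nnsfun S >-> R} of h \* mindic R mNC]%R.
have Eh' x : h' x = (h x * \1_(~` N) x)%R by [].
have -> : sintegral mu h = sintegral mu h'.
  rewrite -!integralT_nnsfun; apply: ae_eq_integral => //.
  - exact/measurable_EFinP.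
  - exact/measurable_EFinP.
  - exists N; split => // x /= Hx; apply: contrapT => Nx; apply: Hx => _; change ((h x)%:E = (h x * \1_(~` N) x)%:E).
    by rewrite indicE mem_set ?mulr1.
rewrite [leRHS]ge0_integralTE; last exact: pos.
apply: ereal_sup_ubound; exists h' => // x; rewrite Eh' indicE.
have [Nx|Nx] := pselect (N x).
  by rewrite memNset ?mulr0; [exact: pos|move=> /(_ Nx)].
rewrite mem_set // mulr1; apply: (le_trans (hf x)).
rewrite !patchE; case: ifPn => //; rewrite inE => Dx.
by apply: contrapT => /negP fg; apply: Nx; apply: HN => /= /(_ Dx); exact/negP.
Qed.

(** The integral is defined for every function, measurable or not, and a null
    set still does not count: a simple function below f can be cut off to 0 on
    the null set without changing its integral. *)
Lemma ae_eq_integral_nonmeasurable (D : set S) (f g : S -> \bar R) :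
  measurable D -> {ae mu, forall x, D x -> f x = g x} ->
  \int[mu]_(x in D) f x = \int[mu]_(x in D) g x.
Proof.
move=> mD fg; rewrite integralE [RHS]integralE; congr (_ - _);
  apply/eqP; rewrite eq_le; apply/andP; split; apply: le_integral_ae_ge0 => //;
  by move: fg; apply: filterS => x H /H; rewrite ?funeposE ?funenegE => ->.
Qed.

End ae_integral.

Section integration_functional.
Local Open Scope ereal_scope.
Context {dT} {S : measurableType dT} {R : realType}.
Implicit Types (f g : S -> \bar R) (Phi Psi : (S -> \bar R) -> \bar R).

(** An iterated integral is easily seen to be a countably additive functional of its
    integrand, whereas writing it as the integral for a measure on the product
    requires that measure to be constructed first. *)
Record integration_functional Phi : Prop := IntegrationFunctional {
  functional_ge0 : forall f, (forall x, 0 <= f x) ->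
    measurable_fun setT f -> 0 <= Phi f ;
  functionalZ : forall (k : R) f, (0 <= k)%R -> (forall x, 0 <= f x) ->
    measurable_fun setT f -> Phi (fun x => k%:E * f x) = k%:E * Phi f ;
  functional_series : forall F : (S -> \bar R)^nat, (forall n x, 0 <= F n x) ->
    (forall n, measurable_fun setT (F n)) ->
    Phi (fun x => \sum_(n <oo) F n x) = \sum_(n <oo) Phi (F n)
}.

Lemma integral_is_functional (mu : {measure set S -> \bar R}) :
  integration_functional (fun f => \int[mu]_x f x).
Proof.
split=> [f f0 mf|k f k0 f0 mf|F F0 mF].
- exact: integral_ge0.
- by rewrite ge0_integralZl.
- by rewrite integral_nneseries.
Qed.

Section one_functional.
Variables (Phi : (S -> \bar R) -> \bar R) (HPhi : integration_functional Phi).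

Lemma functional0 : Phi (fun=> 0) = 0.
Proof.
have := functionalZ HPhi (lexx 0%R) (fun _ => lexx 0) (measurable_cst _).
by under eq_fun do rewrite mul0e; rewrite mul0e.
Qed.

Lemma functionalD f g : (forall x, 0 <= f x) -> (forall x, 0 <= g x) ->
  measurable_fun setT f -> measurable_fun setT g ->
  Phi (fun x => f x + g x) = Phi f + Phi g.
Proof.
move=> f0 g0 mf mg.
have E (a b : \bar R) : 0 <= a -> 0 <= b ->
    \sum_(n <oo) (if n is 0%N then a else if n is 1%N then b else 0) = a + b.
  move=> a0 b0; rewrite (@nneseries_split _ _ 0 2); last by move=> [|[|]].
  rewrite eseries0 ?adde0; last by move=> [|[|]].
  by rewrite big_nat_recl // big_nat1.
pose F n x := if n is 0%N then f x else if n is 1%N then g x else 0.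
have -> : (fun x => f x + g x) = (fun x => \sum_(n <oo) F n x).
  by apply/funext => x; rewrite -E.
rewrite functional_series //; last 2 first.
- by move=> [|[|n]] x /=; rewrite ?f0 ?g0.
- by move=> [|[|n]] //=; exact: measurable_cst.
rewrite -E; [|exact: functional_ge0..].
apply: eq_eseriesr => -[|[|n]] _ //=; exact: functional0.
Qed.

Lemma functional_sum (I : Type) (s : seq I) (F : I -> S -> \bar R) :
  (forall i x, 0 <= F i x) -> (forall i, measurable_fun setT (F i)) ->
  Phi (fun x => \sum_(i <- s) F i x) = \sum_(i <- s) Phi (F i).
Proof.
move=> F0 mF; elim: s => [|i s IH].
  by rewrite big_nil -[RHS]functional0; congr Phi; apply/funext => x; rewrite big_nil.
rewrite big_cons -IH -functionalD //.
- by congr Phi; apply/funext => x; rewrite big_cons.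
- by move=> x; apply: sume_ge0.
- exact: emeasurable_sum.
Qed.

End one_functional.

Import HBSimple HBNNSimple.

(** Countable additivity reaches every nonnegative measurable function because
    such a function is the sum of the increments of its dyadic approximations,
    which are nonnegative simple functions. *)
Lemma eq_functional Phi Psi : integration_functional Phi ->
  integration_functional Psi ->
  (forall A, measurable A ->
    Phi (fun x => (\1_A x)%:E) = Psi (fun x => (\1_A x)%:E)) ->
  forall f, (forall x, 0 <= f x) -> measurable_fun setT f -> Phi f = Psi f.
Proof.
move=> HPhi HPsi indic.
have simple (h : {sfun S >-> R}) : (forall x, (0 <= h x)%R) ->
    Phi (fun x => (h x)%:E) = Psi (fun x => (h x)%:E).
  move=> h0.
  have mi (y : R) : measurable_fun setT (fun x => (\1_(h @^-1` [set y]) x)%:E : \bar R).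
    by apply/measurable_EFinP; exact: measurable_indic.
  pose s : seq R := finmap.enum_fset (fset_set (range h)).
  pose F (y : R) x := (Num.max 0 y)%:E * (\1_(h @^-1` [set y]) x)%:E.
  have F0 y x : 0 <= F y x by rewrite mule_ge0 // lee_fin// le_max lexx.
  have mF y : measurable_fun setT (F y) by exact: measurable_funeM.
  have -> : (fun x => (h x)%:E) = fun x => \sum_(y <- s) F y x.
    apply/funext => x; rewrite fimfunE -fsumEFin; last exact: fimfunP.
    rewrite fsbig_finite /=; last exact: fimfunP.
    rewrite big_seq [RHS]big_seq.
    apply: eq_bigr => y; rewrite in_fset_set ?inE; last exact: fimfunP.
    by move=> [z _ <-]; rewrite /F EFinM max_r.
  rewrite !functional_sum //; apply: eq_bigr => y _.
  rewrite /F !functionalZ ?indic ?le_max ?lexx// => x; by rewrite lee_fin.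
move=> f f0 mf.
pose a n : {nnsfun S >-> R} := nnsfun_approx measurableT mf n.
have nda x : {homo (fun n => a n x) : m n / (m <= n)%N >-> (m <= n)%R}.
  by move=> m n mn; exact/lefP/(nd_nnsfun_approx measurableT mf).
pose F n : {sfun S >-> R} := if n is m.+1 then ((a m.+1 : {sfun S >-> R}) - (a m : {sfun S >-> R}))%R else (a 0%N : {sfun S >-> R}).
have F0 n x : (0 <= F n x)%R.
  by case: n => [|n] /=; [exact: fun_ge0|rewrite subr_ge0; exact: nda].
have sumF n x : (\sum_(0 <= i < n.+1) F i x = a n x)%R.
  elim: n => [|n IH]; first by rewrite big_nat1.
  by rewrite big_nat_recr //= IH /= addrC subrK.
have -> : f = fun x => \sum_(n <oo) (F n x)%:E.
  apply/funext => x; apply/esym/cvg_lim => //.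
  rewrite -cvg_shiftS /=.
  under eq_fun do rewrite sumEFin sumF.
  exact: cvg_nnsfun_approx.
have mF n : measurable_fun setT (fun x => (F n x)%:E) by exact/measurable_EFinP.
rewrite !functional_series //; apply: eq_eseriesr => n _; exact: simple.
Qed.

End integration_functional.

Section build_functional.
Local Open Scope ereal_scope.

Lemma functional_comp dT (S : measurableType dT) dT' (S' : measurableType dT')
    (R : realType) (Phi : (S -> \bar R) -> \bar R) (theta : S -> S') :
  measurable_fun setT theta -> integration_functional Phi ->
  integration_functional (fun f : S' -> \bar R => Phi (f \o theta)).
Proof.
move=> mt HPhi; split=> [f f0 mf|k f k0 f0 mf|F F0 mF].
- by apply: (functional_ge0 HPhi) => [x|]; [exact: f0|exact: measurableT_comp].
- by rewrite -(functionalZ HPhi) // => [x|]; [exact: f0|exact: measurableT_comp].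
- rewrite -(functional_series HPhi) // => [n x|n]; first exact: F0.
  exact: measurableT_comp.
Qed.

Lemma functional_mix dQ (Q : measurableType dQ) dT (S : measurableType dT)
    (R : realType) (mu : {measure set Q -> \bar R}) (wt : Q -> R)
    (Phi : Q -> (S -> \bar R) -> \bar R) :
  (forall q, 0 <= wt q)%R -> measurable_fun setT wt ->
  (forall q, integration_functional (Phi q)) ->
  (forall f, (forall x, 0 <= f x) -> measurable_fun setT f ->
     measurable_fun setT (fun q => Phi q f)) ->
  integration_functional (fun f => \int[mu]_q ((wt q)%:E * Phi q f)).
Proof.
move=> w0 mw HPhi mPhi.
have mw' : measurable_fun setT (fun q => (wt q)%:E) by exact/measurable_EFinP.
split=> [f f0 mf|k f k0 f0 mf|F F0 mF].
- by apply: integral_ge0 => q _; rewrite mule_ge0 ?lee_fin //; exact: functional_ge0.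
- rewrite -ge0_integralZl //.
  + by apply: eq_integral => q _; rewrite functionalZ // muleCA.
  + by apply: emeasurable_funM => //; exact: mPhi.
  + by move=> q _; rewrite mule_ge0 ?lee_fin //; exact: functional_ge0.
- rewrite -integral_nneseries //.
  + apply: eq_integral => q _; rewrite functional_series // nneseriesZl // => n _.
    exact: functional_ge0.
  + by move=> n; apply: emeasurable_funM => //; exact: mPhi.
  + by move=> n q _; rewrite mule_ge0 ?lee_fin //; exact: functional_ge0.
Qed.

Lemma functional_restrict dT (S : measurableType dT) dT' (S' : measurableType dT')
    (R : realType) (Phi : (S * S' -> \bar R) -> \bar R) (A : set S) :
  measurable A -> integration_functional Phi ->
  integration_functional (fun f : S' -> \bar R =>
    Phi (fun p => (\1_A p.1)%:E * f p.2)).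
Proof.
move=> mA HPhi.
have mi : measurable_fun setT (fun p : S * S' => (\1_A p.1)%:E : \bar R).
  by apply/measurable_EFinP; apply: measurableT_comp => //; exact: measurable_indic.
have mf2 (f : S' -> \bar R) : measurable_fun setT f ->
    measurable_fun setT (fun p : S * S' => (\1_A p.1)%:E * f p.2).
  by move=> mf; apply: emeasurable_funM => //; exact: measurableT_comp.
split=> [f f0 mf|k f k0 f0 mf|F F0 mF].
- apply: (functional_ge0 HPhi) => [x|]; last exact: mf2.
  by rewrite mule_ge0 ?lee_fin.
- rewrite -(functionalZ HPhi) => //.
  + by congr Phi; apply/funext => p; rewrite muleCA.
  + by move=> x; rewrite mule_ge0 ?lee_fin.
  + exact: mf2.
- rewrite -(functional_series HPhi) => [|n x|n]; last exact: mf2.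
  + by congr Phi; apply/funext => p; rewrite nneseriesZl.
  + by rewrite mule_ge0 ?lee_fin.
Qed.

End build_functional.

Section functional_measure.
Local Open Scope ereal_scope.
Context {dT} {S : measurableType dT} {R : realType}.
Variables (Phi : (S -> \bar R) -> \bar R) (HPhi : integration_functional Phi).

(** Nothing is assumed of Phi on functions that are not measurable, whence the value
    0 on the other sets: a measure has to be nonnegative on all of them. *)
Definition functional_measure of integration_functional Phi := fun A : set S =>
  if pselect (measurable A) then Phi (fun x => (\1_A x)%:E) else 0.

Lemma functional_measureE A : measurable A ->
  functional_measure HPhi A = Phi (fun x => (\1_A x)%:E).
Proof. by rewrite /functional_measure; case: pselect. Qed.

Let mindicE (A : set S) : measurable A ->
  measurable_fun setT (fun x => (\1_A x)%:E : \bar R).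
Proof. by move=> mA; apply/measurable_EFinP; exact: measurable_indic. Qed.

Let functional_measure0 : functional_measure HPhi set0 = 0.
Proof.
rewrite functional_measureE // -[RHS](functional0 HPhi); congr Phi.
by apply/funext => x; rewrite indic0.
Qed.

Let functional_measure_ge0 A : 0 <= functional_measure HPhi A.
Proof.
rewrite /functional_measure; case: pselect => // mA.
by apply: (functional_ge0 HPhi); [move=> x; rewrite lee_fin|exact: mindicE].
Qed.

Let functional_measure_sigma_additive :
  semi_sigma_additive (functional_measure HPhi).
Proof.
move=> F mF tF mUF; rewrite functional_measureE //.
under eq_fun do under eq_bigr do rewrite functional_measureE //.
have -> : (fun x => (\1_(\bigcup_n F n) x)%:E) =
    fun x => \sum_(n <oo) (\1_(F n) x)%:E :> \bar R.
  by apply/funext => x; rewrite indic_bigcup.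
rewrite functional_series //; last by move=> n; exact: mindicE.
apply: is_cvg_nneseries => n _ _.
by apply: (functional_ge0 HPhi); [move=> x; rewrite lee_fin|exact: mindicE].
Qed.

HB.instance Definition _ := isMeasure.Build _ _ _ (functional_measure HPhi)
  functional_measure0 functional_measure_ge0 functional_measure_sigma_additive.

End functional_measure.

Section functional_uniqueness.
Local Open Scope ereal_scope.

Lemma eq_functional_pi dT (S : measurableType dT) (R : realType)
    (Phi Psi : (S -> \bar R) -> \bar R) (G : set (set S)) :
  integration_functional Phi -> integration_functional Psi ->
  @measurable _ S = <<s G >> -> setI_closed G -> G setT ->
  (forall A, G A -> Phi (fun x => (\1_A x)%:E) = Psi (fun x => (\1_A x)%:E)) ->
  Phi (fun=> 1) < +oo ->
  forall f, (forall x, 0 <= f x) -> measurable_fun setT f -> Phi f = Psi f.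
Proof.
move=> HPhi HPsi mG GI GT PhiPsi Phi1; apply: eq_functional => // A mA.
rewrite -(functional_measureE HPhi mA) -(functional_measureE HPsi mA).
apply: (@measure_unique _ _ _ G (fun=> setT)) => //.
- by rewrite bigcup_const.
- move=> B GB; have mB : measurable B by rewrite mG; exact: sub_sigma_algebra.
  by rewrite /= !functional_measureE //; exact: PhiPsi.
- by move=> _; rewrite /= functional_measureE // indicT.
Qed.

Lemma eq_functional_prod dT (S : measurableType dT) dT' (S' : measurableType dT')
    (R : realType) (Phi Psi : (S * S' -> \bar R) -> \bar R) :
  integration_functional Phi -> integration_functional Psi ->
  (forall A B, measurable A -> measurable B ->
    Phi (fun p => (\1_A p.1 * \1_B p.2)%:E) = Psi (fun p => (\1_A p.1 * \1_B p.2)%:E)) ->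
  Phi (fun=> 1) < +oo ->
  forall f, (forall x, 0 <= f x) -> measurable_fun setT f -> Phi f = Psi f.
Proof.
move=> HPhi HPsi PhiPsi Phi1.
apply: (@eq_functional_pi _ _ _ _ _
  [set A `*` B | A in @measurable _ S & B in @measurable _ S']) => //.
- exact: measurable_prod_measurableType.
- move=> _ _ [A mA [B mB <-]] [C mC [D mD <-]].
  exists (A `&` C); first exact: measurableI.
  by exists (B `&` D); [exact: measurableI|rewrite setXI].
- by exists setT => //; exists setT => //; rewrite setXTT.
- move=> _ [A mA [B mB <-]].
  have -> : (fun p : S * S' => (\1_(A `*` B) p)%:E : \bar R) =
      fun p => (\1_A p.1 * \1_B p.2)%:E.
    by apply/funext => -[x y]; rewrite !indicE in_setX /= -natrM mulnb.
  exact: PhiPsi.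
Qed.

(** With A fixed in the first factor, both functionals become functionals on the
    last two factors and agree there; so they agree on all A `*` E. *)
Lemma eq_functional_prod3 dT (S : measurableType dT) dT' (S' : measurableType dT')
    dT2 (S2 : measurableType dT2)
    (R : realType) (Phi Psi : (S * (S' * S2) -> \bar R) -> \bar R) :
  integration_functional Phi -> integration_functional Psi ->
  (forall A B C, measurable A -> measurable B -> measurable C ->
    Phi (fun p => (\1_A p.1 * (\1_B p.2.1 * \1_C p.2.2))%:E) =
    Psi (fun p => (\1_A p.1 * (\1_B p.2.1 * \1_C p.2.2))%:E)) ->
  Phi (fun=> 1) < +oo ->
  forall f, (forall x, 0 <= f x) -> measurable_fun setT f -> Phi f = Psi f.
Proof.
move=> HPhi HPsi PhiPsi Phi1; apply: eq_functional_prod => // A E mA mE.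
have mi : measurable_fun setT (fun p : S * (S' * S2) => (\1_A p.1)%:E : \bar R).
  by apply/measurable_EFinP; apply: measurableT_comp => //; exact: measurable_indic.
have key := eq_functional_prod (functional_restrict mA HPhi)
  (functional_restrict mA HPsi).
transitivity (Phi (fun p => (\1_A p.1)%:E * (\1_E p.2)%:E)) => //.
rewrite (key _ _ (fun p => (\1_E p)%:E)) //.
- by move=> B C mB mC; exact: PhiPsi.
- apply: le_lt_trans Phi1.
  have -> : (fun=> 1) = (fun p => (\1_A p.1)%:E * 1 + (\1_(~` A) p.1)%:E)
      :> (S * (S' * S2) -> \bar R).
    apply/funext => p; rewrite !indicE in_setC.
    by case: (p.1 \in A); rewrite ?mul1e ?mul0e ?adde0 ?add0e.
  have mj : measurable_fun setT (fun p : S * (S' * S2) => (\1_(~` A) p.1)%:E : \bar R).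
    apply/measurable_EFinP; apply: measurableT_comp => //.
    by apply: measurable_indic; exact: measurableC.
  rewrite (functionalD HPhi) //.
  + by apply: leeDl; exact: (functional_ge0 HPhi).
  + by under eq_fun do rewrite mule1.
- by apply/measurable_EFinP; exact: measurable_indic.
Qed.

End functional_uniqueness.

(** * Null sets and reflections *)

Section null_sets.
Local Open Scope ereal_scope.

Definition image_functional dT (S : measurableType dT) dT' (S' : measurableType dT')
    (R : realType) (mu : {measure set S -> \bar R}) (theta : S -> S') :=
  fun f : S' -> \bar R => \int[mu]_x f (theta x).

Lemma image_is_functional dT (S : measurableType dT) dT' (S' : measurableType dT')
    (R : realType) (mu : {measure set S -> \bar R}) (theta : S -> S') :
  measurable_fun setT theta -> integration_functional (image_functional mu theta).
Proof. by move=> mt; exact: (functional_comp mt (integral_is_functional mu)). Qed.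

Lemma image_functional_indic dT (S : measurableType dT) dT' (S' : measurableType dT')
    (R : realType) (mu : {measure set S -> \bar R}) (theta : S -> S') A :
  measurable_fun setT theta -> measurable A ->
  image_functional mu theta (fun x => (\1_A x)%:E) = mu (theta @^-1` A).
Proof.
move=> mt mA; rewrite /image_functional.
rewrite (_ : (fun x => _) = fun x => (\1_(theta @^-1` A) x)%:E).
  rewrite integral_indic ?setIT //.
  by rewrite -[X in measurable X]setTI; exact: mt.
by apply/funext.
Qed.

Lemma ae_comp dT (S : measurableType dT) (R : realType)
    (mu : {measure set S -> \bar R}) (theta : S -> S) (Q : S -> Prop) :
  measurable_fun setT theta ->
  (forall A, measurable A -> mu (theta @^-1` A) = mu A) ->
  {ae mu, forall x, Q x} -> {ae mu, forall x, Q (theta x)}.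
Proof.
move=> mt mut [N [mN N0 HN]]; exists (theta @^-1` N); split.
- by rewrite -[X in measurable X]setTI; exact: mt.
- by rewrite mut.
- by move=> x /= nQ; exact: HN.
Qed.

Lemma ae_product_section dT (S : measurableType dT) dT' (S' : measurableType dT')
    (R : realType) (m1 : {sigma_finite_measure set S -> \bar R})
    (m2 : {sigma_finite_measure set S' -> \bar R}) (Q : S * S' -> Prop) :
  {ae m1 \x m2, forall p, Q p} ->
  {ae m2, forall y, {ae m1, forall x, Q (x, y)}}.
Proof.
move=> [N [mN N0 HN]].
have mi : measurable_fun setT (fun p : S * S' => (\1_N p)%:E : \bar R).
  by apply/measurable_EFinP; exact: measurable_indic.
have : \int[m2]_y fubini_G m1 (fun p => (\1_N p)%:E) y = 0.
  by rewrite -fubini_tonelli2 // integral_indic // setIT.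
have G0 y : 0 <= fubini_G m1 (fun p => (\1_N p)%:E) y.
  by apply: integral_ge0 => x _; rewrite lee_fin.
rewrite -(eq_integral _ _ (fun y _ => gee0_abs (G0 y))).
move=> /ae_eq_integral_abs -/(_ measurableT) H.
have /H : measurable_fun setT (fubini_G m1 (fun p => (\1_N p)%:E)).
  exact: measurable_fun_fubini_tonelli_G.
apply: filterS => y /(_ I) /=.
rewrite /fubini_G.
rewrite (_ : (fun x => _) = fun x => (\1_(ysection N y) x)%:E); last first.
  by apply/funext => x; rewrite !indicE mem_ysection.
have mNy := measurable_ysection y mN.
rewrite integral_indic // setIT => Ny0.
exists (ysection N y); split => // x /= nQ.
by rewrite /ysection /= inE; exact: HN.
Qed.

End null_sets.

Section lebesgue_reflection.
Context {R : realType}.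

Lemma lebesgue_measure_reflect (c : R) A : measurable A ->
  lebesgue_measure ((fun x : R => c - x) @^-1` A) = lebesgue_measure A.
Proof.
move=> mA; have mt : measurable_fun [set: measurableTypeR R] (fun x : measurableTypeR R => c - x : measurableTypeR R).
  exact: measurable_funB.
rewrite -(image_functional_indic _ mt mA).
rewrite -(functional_measureE (image_is_functional _ mt) mA).
apply/esym/(@lebesgue_measure_unique R) => // _ [[a b]] _ <-.
rewrite /= functional_measureE // image_functional_indic //.
have -> : (fun x => c - x) @^-1` `]a, b] = `[c - b, c - a[%classic.
  by apply/seteqP; split=> x; rewrite /= !in_itv /= => /andP[? ?]; apply/andP; split; lra.
rewrite lebesgue_measure_itv; apply/esym; apply: (etrans (lebesgue_measure_itv _)).
rewrite /= !lte_fin.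
have -> : (c - b < c - a) = (a < b) by apply/idP/idP; lra.
by case: ifP => // _; rewrite -!EFinB; congr EFin; ring.
Qed.

Lemma measurable_rV_reflect n (c : 'rV[R]_n) :
  measurable_fun setT (fun v : 'rV[R]_n => c - v).
Proof.
apply: measurable_fun_rV => i.
rewrite (_ : (fun x => _) = fun x : 'rV[R]_n => c ord0 i - x ord0 i).
  by apply: measurable_funB => //; exact: measurable_coord.
by apply/funext => x; rewrite !mxE.
Qed.

(** One coordinate at a time: under the identification of R^(n+1) with R * R^n
    the reflection acts on both factors, and the product measure is determined
    by its values on rectangles. *)
Lemma lebesgue_rV_reflect n (c : 'rV[R]_n) A : measurable A ->
  lebesgue_rV n ((fun v => c - v) @^-1` A) = lebesgue_rV n A.
Proof.
elim: n c A => [|n IH] c A mA.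
  rewrite /= !diracE; congr ((nat_of_bool _)%:R%:E).
  by apply/idP/idP; rewrite !inE /=; congr A; apply/rowP => -[].
have consl y (u : 'rV[R]_n) : rV_cons (y, u) ord0 ord0 = y.
  exact: (congr1 fst (rV_consK (y, u))).
have consr y (u : 'rV[R]_n) k : rV_cons (y, u) ord0 (lift ord0 k) = u ord0 k.
  transitivity (rV_cons (y, u) ord0 (rshift 1 k)); last exact: row_mxEr.
  by congr (rV_cons _ _ _); exact/val_inj.
pose r1 := fun x : measurableTypeR R => c ord0 ord0 - x : measurableTypeR R.
pose c' := (rV_uncons c).2.
pose r2 := fun v : 'rV[R]_n => c' - v.
pose r := fun p : measurableTypeR R * 'rV[R]_n => (r1 p.1, r2 p.2) : measurableTypeR R * 'rV[R]_n.
have mr1 : measurable_fun setT r1 by exact: measurable_funB.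
have mr2 : measurable_fun setT r2 by exact: measurable_rV_reflect.
have mr : measurable_fun setT r.
  by apply: measurable_fun_pair; exact: measurableT_comp.
have mA' : measurable (@rV_cons R n @^-1` A : set (measurableTypeR R * 'rV[R]_n)).
  by rewrite -[X in measurable X]setTI; exact: measurable_rV_cons.
change ((@lebesgue_measure R \x lebesgue_rV n)%E (@rV_cons R n @^-1` ((fun v => c - v) @^-1` A)) = (@lebesgue_measure R \x lebesgue_rV n)%E (@rV_cons R n @^-1` A)).
have reflect_cons x v : c - rV_cons (x, v) = rV_cons (r (x, v)).
  apply/rowP => i; rewrite mxE [X in _ + X]mxE.
  case: (unliftP ord0 i) => [k|] ->; rewrite ?consl ?consr //.
  rewrite /r2 /c' /= !mxE; congr (c _ _ - _); exact/val_inj.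
have -> : @rV_cons R n @^-1` ((fun v => c - v) @^-1` A) =
    r @^-1` (@rV_cons R n @^-1` A).
  by apply/seteqP; split=> -[x v] /=; rewrite reflect_cons.
apply: (etrans (esym (image_functional_indic (@lebesgue_measure R \x lebesgue_rV n)%E mr mA'))).
apply: (etrans (esym (functional_measureE (image_is_functional _ mr) mA'))).
apply/esym/product_measure_unique => // B C mB mC.
have mBC : measurable (B `*` C) by exact: measurableX.
rewrite /= functional_measureE // image_functional_indic //.
rewrite -[LHS]/((lebesgue_measure \x lebesgue_rV n)%E ((r1 @^-1` B) `*` (r2 @^-1` C))).
rewrite product_measure1E ?lebesgue_measure_reflect ?IH //.
- by congr (_ * _)%E; exact: lebesgue_measure_reflect.
- by have := mr1 measurableT B mB; rewrite setTI.
- by have := mr2 measurableT C mC; rewrite setTI.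
Qed.

Lemma measurable_rV_set1 n (c : 'rV[R]_n) : measurable [set c].
Proof.
rewrite (_ : [set c] = [set v | forall i, [set c ord0 i] (v ord0 i)]).
  by apply: (measurable_box (A := fun i => [set c ord0 i])) => i; exact: measurable_set1.
by apply/seteqP; split=> [v -> //|v /= H]; apply/rowP.
Qed.

Lemma lebesgue_rV_set1 n (c : 'rV[R]_n) : (0 < n)%N ->
  lebesgue_rV n [set c] = 0%E.
Proof.
case: n c => // n c _.
rewrite (_ : [set c] = [set v | forall i, [set c ord0 i] (v ord0 i)]).
  rewrite (lebesgue_rV_box (A := fun i => [set c ord0 i])) => [|i]; last exact: measurable_set1.
  by rewrite big_ord_recl lebesgue_measure_set1 mul0e.
by apply/seteqP; split=> [v -> //|v /= H]; apply/rowP.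
Qed.

End lebesgue_reflection.

(** * Measurability of the cut-off values *)

Section complex_measurability.
Context {R : realType} {dS} {S : measurableType dS}.
Implicit Types f g : S -> R[i].

Definition measurable_complex f : Prop :=
  measurable_fun setT (fun s => complex.Re (f s)) /\
  measurable_fun setT (fun s => complex.Im (f s)).

Lemma measurable_complex_cst (z : R[i]) : measurable_complex (fun=> z).
Proof. by split; exact: measurable_cst. Qed.

Lemma measurable_complex_real (r : S -> R) : measurable_fun setT r ->
  measurable_complex (fun s => (r s)%:C%C).
Proof. by move=> mr; split => //=; exact: measurable_cst. Qed.

Lemma ReD (a b : R[i]) : complex.Re (a + b) = complex.Re a + complex.Re b.
Proof. by case: a; case: b. Qed.

Lemma ImD (a b : R[i]) : complex.Im (a + b) = complex.Im a + complex.Im b.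
Proof. by case: a; case: b. Qed.

Lemma ReM (a b : R[i]) : complex.Re (a * b) =
  complex.Re a * complex.Re b - complex.Im a * complex.Im b.
Proof. by case: a; case: b. Qed.

Lemma ImM (a b : R[i]) : complex.Im (a * b) =
  complex.Re a * complex.Im b + complex.Im a * complex.Re b.
Proof. by case: a; case: b. Qed.

Lemma measurable_complexD f g : measurable_complex f -> measurable_complex g ->
  measurable_complex (fun s => f s + g s).
Proof.
move=> [f1 f2] [g1 g2]; split.
- by under eq_fun do rewrite ReD; exact: measurable_funD.
- by under eq_fun do rewrite ImD; exact: measurable_funD.
Qed.

Lemma measurable_complexM f g : measurable_complex f -> measurable_complex g ->
  measurable_complex (fun s => f s * g s).
Proof.
move=> [f1 f2] [g1 g2]; split.
- under eq_fun do rewrite ReM.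
  by apply: measurable_funB; exact: measurable_funM.
- under eq_fun do rewrite ImM.
  by apply: measurable_funD; exact: measurable_funM.
Qed.

Lemma measurable_complexB f g : measurable_complex f -> measurable_complex g ->
  measurable_complex (fun s => f s - g s).
Proof.
move=> mf mg; under eq_fun do rewrite -mulN1r.
apply: measurable_complexD => //; exact: measurable_complexM.
Qed.

Lemma measurable_complex_sum (I : Type) (l : seq I) (F : I -> S -> R[i]) :
  (forall i, measurable_complex (F i)) ->
  measurable_complex (fun s => \sum_(i <- l) F i s).
Proof.
move=> mF; elim: l => [|i l IH].
  by under eq_fun do rewrite big_nil; exact: measurable_complex_cst.
by under eq_fun do rewrite big_cons; exact: measurable_complexD.
Qed.

Lemma measurable_complex_if (b : S -> bool) f g : measurable_fun setT b ->
  measurable_complex f -> measurable_complex g ->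
  measurable_complex (fun s => if b s then f s else g s).
Proof.
move=> mb [f1 f2] [g1 g2]; split.
- by under eq_fun do rewrite (fun_if (@complex.Re R)); exact: measurable_fun_ifT.
- by under eq_fun do rewrite (fun_if (@complex.Im R)); exact: measurable_fun_ifT.
Qed.

End complex_measurability.

Section vector_measurability.
Context {R : realType} {d : nat} {dS} {S : measurableType dS}.
Local Notation Vec := 'rV[R]_d.
Local Notation Cvec := 'rV[R[i]]_d.

Definition measurable_cvec (f : S -> Cvec) : Prop :=
  forall j, measurable_complex (fun s => f s ord0 j).

Lemma measurable_cvecZ (k : S -> R[i]) (f : S -> Cvec) :
  measurable_complex k -> measurable_cvec f ->
  measurable_cvec (fun s => k s *: f s).
Proof.
by move=> mk mf j; under eq_fun do rewrite mxE; exact: measurable_complexM.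
Qed.

Lemma measurable_cvecD (f g : S -> Cvec) :
  measurable_cvec f -> measurable_cvec g ->
  measurable_cvec (fun s => f s + g s).
Proof.
by move=> mf mg j; under eq_fun do rewrite mxE; exact: measurable_complexD.
Qed.

Lemma measurable_cvec_if (b : S -> bool) (f g : S -> Cvec) :
  measurable_fun setT b -> measurable_cvec f -> measurable_cvec g ->
  measurable_cvec (fun s => if b s then f s else g s).
Proof.
move=> mb mf mg j.
under eq_fun do rewrite (fun_if (fun A : Cvec => A ord0 j)).
exact: measurable_complex_if.
Qed.

Lemma measurable_sqrt : measurable_fun setT (@Num.sqrt R).
Proof. by apply: continuous_measurable_fun; exact: sqrt_continuous. Qed.

Lemma measurable_enorm : measurable_fun setT (@enorm R d).
Proof.
apply: (measurableT_comp measurable_sqrt).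
apply: measurable_sum => j; apply: measurable_funX; exact: measurable_coord.
Qed.

Lemma measurable_cdot (f g : S -> Cvec) : measurable_cvec f -> measurable_cvec g ->
  measurable_complex (fun s => cdot (f s) (g s)).
Proof.
by move=> mf mg; apply: measurable_complex_sum => j; exact: measurable_complexM.
Qed.

Lemma measurable_direction (xi : S -> Vec) : measurable_fun setT xi ->
  measurable_cvec (fun s => direction (xi s)).
Proof.
move=> mxi j; under eq_fun do rewrite mxE; apply: measurable_complex_real.
have e0 x : 0 <= @enorm R d x by exact: sqrtr_ge0.
(* the norm is nonnegative: its inverse is a real power, also at 0 *)
under eq_fun do rewrite -powR_inv1 //.
apply: measurable_funM.
  exact: (measurableT_comp (measurable_coord j) mxi).
apply: (measurableT_comp (@measurable_powR R (-1))).
exact: (measurableT_comp measurable_enorm).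
Qed.

Lemma measurable_odot (xi : S -> Vec) (a b : S -> Cvec) :
  measurable_fun setT xi -> measurable_cvec a -> measurable_cvec b ->
  measurable_cvec (fun s => odot (xi s) (a s) (b s)).
Proof.
move=> mxi ma mb.
have md := measurable_direction mxi.
have mp (c : S -> Cvec) : measurable_cvec c ->
    measurable_cvec (fun s => perp_proj (xi s) (c s)).
  move=> mc j; under eq_fun do rewrite !mxE.
  apply: measurable_complexB => //; apply: measurable_complexM.
    exact: measurable_cdot.
  by have := md j; under eq_fun do rewrite mxE.
apply: measurable_cvecZ; first exact: measurable_complex_cst.
by apply: measurable_cvecD; apply: measurable_cvecZ; (exact: measurable_cdot || exact: mp).
Qed.

Lemma measurable_cnorm (f : S -> Cvec) : measurable_cvec f ->
  measurable_fun setT (fun s => cnorm (f s)).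
Proof.
move=> mf; apply: (measurableT_comp measurable_sqrt).
apply: measurable_sum => j; apply: measurable_funD; apply: measurable_funX;
  by case: (mf j).
Qed.

End vector_measurability.

Lemma measurable_cvec_comp {R : realType} {d : nat} dS (S : measurableType dS)
    dS' (S' : measurableType dS') (f : S -> 'rV[R[i]]_d) (theta : S' -> S) :
  measurable_fun setT theta -> measurable_cvec f -> measurable_cvec (f \o theta).
Proof.
move=> mt mf j; have [f1 f2] := mf j.
by split; [exact: (measurableT_comp f1)|exact: (measurableT_comp f2)].
Qed.

Section family_measurability.
Context {R : realType} {d : nat}.
Local Notation Vec := 'rV[R]_d.
Local Notation Cvec := 'rV[R[i]]_d.

Definition family_cylinders : set (set (vertex -> Vec * R)) :=
  [set E | exists i (B : set (Vec * R)), measurable B /\ E = [set f | B (f i)] ].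

Local Notation FamT := (g_sigma_algebraType family_cylinders).

Lemma measurable_eval u : measurable_fun setT (fun x : FamT => x u).
Proof.
move=> _ B mB; rewrite setTI; apply: sub_sigma_algebra.
by exists u, B.
Qed.

Lemma measurable_family dS (S : measurableType dS) (f : S -> FamT) :
  (forall u, measurable_fun setT (fun s => f s u)) -> measurable_fun setT f.
Proof.
move=> mf; have := @measurability _ _ S FamT setT f family_cylinders erefl; apply.
by move=> _ [_ [u [B [mB ->]]] <-]; apply: (mf u).
Qed.

Lemma measurable_subfamily b :
  measurable_fun setT (subfamily b : FamT -> FamT).
Proof. by apply: measurable_family => u; exact: measurable_eval. Qed.

Let measurable_time : measurable_fun setT (fun p : FamT * R => (p.1 [::]).2).
Proof.
apply: (measurableT_comp (f := snd)) => //.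
by apply: (measurableT_comp (measurable_eval [::])).
Qed.

Let measurable_position : measurable_fun setT (fun p : FamT * R => (p.1 [::]).1).
Proof.
apply: (measurableT_comp (f := fst)) => //.
by apply: (measurableT_comp (measurable_eval [::])).
Qed.

Let descend b (p : FamT * R) : FamT * R := (subfamily b p.1, p.2 - (p.1 [::]).2).

Let measurable_descend b : measurable_fun setT (descend b).
Proof.
apply: measurable_fun_pair.
  by apply: (measurableT_comp (measurable_subfamily b)).
exact: measurable_funB.
Qed.

Let measurable_root_stops :
  measurable_fun setT (fun p : FamT * R => p.2 <= (p.1 [::]).2).
Proof. exact: measurable_fun_ler. Qed.

Lemma measurable_stops n :
  measurable_fun setT (fun p : FamT * R => stops n p.1 p.2).
Proof.
elim: n => [|n IH] /=; first exact: measurable_cst.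
apply: measurable_or => //; apply: measurable_and.
- exact: (measurableT_comp IH (measurable_descend false)).
- exact: (measurableT_comp IH (measurable_descend true)).
Qed.

Lemma measurable_truncated (chi0 : Vec -> Cvec) n : measurable_cvec_fun chi0 ->
  measurable_cvec (fun p : FamT * R => truncated chi0 n p.1 p.2).
Proof.
move=> mchi0; elim: n => [|n IH] /=.
  move=> j; rewrite (_ : (fun _ => _) = fun=> 0); first exact: measurable_complex_cst.
  by apply/funext => p; rewrite mxE.
apply: measurable_cvec_if => //.
- by move=> j; have [h1 h2] := mchi0 j; split;
    [exact: (measurableT_comp h1)|exact: (measurableT_comp h2)].
- apply: measurable_odot => //.
  + exact: (measurable_cvec_comp (measurable_descend false) IH).
  + exact: (measurable_cvec_comp (measurable_descend true) IH).
Qed.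

(** There are countably many lists, so the event splits into countably many ones
    that prescribe the lists of the two subtrees. *)
Lemma measurable_branching_nodes n l :
  measurable [set p : FamT * R | branching_nodes n p.1 p.2 = l].
Proof.
elim: n l => [|n IH] l /=.
  have [->|/eqP nl] := eqVneq l [::].
    by rewrite (_ : [set _ | _] = setT) //; apply/seteqP; split.
  rewrite (_ : [set _ | _] = set0) //; apply/seteqP; split => // p /=.
  by move=> El; apply: nl.
have mroot (b : bool) : measurable [set p : FamT * R | (p.2 <= (p.1 [::]).2) = b].
  have := measurable_root_stops measurableT (Y := [set b]) I.
  by rewrite setTI.
pose combine (q : seq vertex * seq vertex) : seq vertex :=
  [::] :: map (cons false) q.1 ++ map (cons true) q.2.
rewrite (_ : [set _ | _] =
  ([set p : FamT * R | (p.2 <= (p.1 [::]).2) = true] `&` [set _ | [::] = l]) `|`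
  ([set p : FamT * R | (p.2 <= (p.1 [::]).2) = false] `&`
   \bigcup_(q in [set q | combine q = l])
     (descend false @^-1` [set p | branching_nodes n p.1 p.2 = q.1] `&`
      descend true @^-1` [set p | branching_nodes n p.1 p.2 = q.2]))).
  apply: measurableU; apply: measurableI; do ?exact: mroot.
    have [El|nl] := pselect ([::] = l).
      by rewrite (_ : [set _ | _] = setT) //; apply/seteqP; split.
    by rewrite (_ : [set _ | _] = set0) //; apply/seteqP; split.
  rewrite bigcup_mkcond; apply: countable_bigcupT_measurable => [|q].
    exact: countableP.
  case: ifP => // _; apply: measurableI.
    by have := measurable_descend false measurableT (IH q.1); rewrite setTI.
  by have := measurable_descend true measurableT (IH q.2); rewrite setTI.
apply/seteqP; split => p /=.
  case: ifPn => [pr El|pr El]; [left|right] => //; split; first exact/negbTE.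
  by exists (branching_nodes n (subfamily false p.1) (p.2 - (p.1 [::]).2),
             branching_nodes n (subfamily true p.1) (p.2 - (p.1 [::]).2)).
by move=> [[-> <-]//|[-> [q <- [/= -> ->]]]].
Qed.

End family_measurability.

(** * Thinned and minimal processes *)

Section limit_value.
Context {R : realType} {d : nat}.
Local Notation Vec := 'rV[R]_d.
Local Notation Cvec := 'rV[R[i]]_d.
Local Notation FamT := (g_sigma_algebraType (@family_cylinders R d)).
Variable chi0 : Vec -> Cvec.

(** The minimal process as a function of the family alone. It agrees with
    [minimal_process] only for positive times, but being defined without the
    explosion time it is a limit of cut-off values for every family, hence
    measurable. *)
Definition limit_value (x : vertex -> Vec * R) (t : R) : Cvec :=
  xget 0 [set a | exists2 n, stops n x t & a = truncated chi0 n x t].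

Lemma limit_value_stops n x t : stops n x t ->
  limit_value x t = truncated chi0 n x t.
Proof.
move=> Hn; rewrite /limit_value; case: xgetP => [a _ /= [m Hm ->]|].
  exact: stops_unique.
by move=> /(_ (truncated chi0 n x t)) /=; case; exists n.
Qed.

Lemma limit_value_nonstop x t : (forall n, ~~ stops n x t) -> limit_value x t = 0.
Proof.
move=> Hn; rewrite /limit_value; case: xgetP => // a _ /= [n].
by rewrite (negbTE (Hn n)).
Qed.

Lemma truncated_near_limit_value x t :
  \forall n \near \oo, truncated chi0 n x t = limit_value x t.
Proof.
have [[n Hn]|/forallNP Hn] := pselect (exists n, stops n x t).
  exists n => // m /= nm; rewrite (limit_value_stops Hn).
  by have [_ -> _] := stops_stable chi0 nm Hn.
apply: nearW => n; rewrite limit_value_nonstop => [|m]; last exact/negP.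
by apply: truncated_eq0; exact/negP.
Qed.

Lemma truncated_limit_valueE n x t :
  truncated chi0 n x t = if stops n x t then limit_value x t else 0.
Proof.
by case: ifPn => [/limit_value_stops ->//|]; exact: truncated_eq0.
Qed.

Hypothesis mchi0 : measurable_cvec_fun chi0.

Lemma measurable_truncated_at n t :
  measurable_cvec (fun x : FamT => truncated chi0 n x t).
Proof.
have mp : measurable_fun setT (fun x : FamT => (x, t)).
  by apply: measurable_fun_pair => //; exact: measurable_cst.
exact: (measurable_cvec_comp mp (measurable_truncated n mchi0)).
Qed.

Lemma measurable_limit_value t :
  measurable_cvec (fun x : FamT => limit_value x t).
Proof.
have key (L : Cvec -> R) :
    (forall n, measurable_fun setT (fun x : FamT => L (truncated chi0 n x t))) ->
    measurable_fun setT (fun x : FamT => L (limit_value x t)).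
  move=> mL; apply: (measurable_fun_cvg mL) => x _.
  apply: cvg_near_cst; near do (congr L).
  exact: truncated_near_limit_value.
move=> j; split; [apply: (key (fun a => complex.Re (a ord0 j)))
                 |apply: (key (fun a => complex.Im (a ord0 j)))];
  by move=> n; have [] := measurable_truncated_at n t j.
Unshelve. all: by end_near. Qed.

End limit_value.

Section partition.
Local Open Scope ereal_scope.

Lemma eq_integral_partition dS (S : measurableType dS) (R : realType)
    (mu : {measure set S -> \bar R}) (F : (set S)^nat) (f g : S -> \bar R) :
  (forall k, measurable (F k)) -> trivIset setT F ->
  (forall x, 0 <= f x) -> (forall x, 0 <= g x) ->
  (forall k, measurable_fun (F k) f) -> (forall k, measurable_fun (F k) g) ->
  (forall x, ~ (\bigcup_k F k) x -> f x = 0) ->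
  (forall x, ~ (\bigcup_k F k) x -> g x = 0) ->
  (forall k, \int[mu]_(x in F k) f x = \int[mu]_(x in F k) g x) ->
  \int[mu]_x f x = \int[mu]_x g x.
Proof.
move=> mF tF f0 g0 mf mg f00 g00 fg.
have E k : (forall x, ~ (\bigcup_k F k) x -> k x = 0) ->
    \int[mu]_x k x = \int[mu]_(x in \bigcup_k F k) k x.
  move=> k0; rewrite [RHS]integral_mkcond; apply: eq_integral => x _.
  by rewrite patchE; case: ifPn => //; rewrite notin_setE => /k0.
rewrite (E f) // (E g) // !ge0_integral_bigcup //.
- by apply: eq_eseriesr.
- by apply/measurable_fun_bigcup.
- by apply/measurable_fun_bigcup.
Qed.

End partition.

Section thinning.
Context {R : realType} {d : nat}.
Local Notation Vec := 'rV[R]_d.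
Local Notation Cvec := 'rV[R[i]]_d.
Local Notation FamT := (g_sigma_algebraType (@family_cylinders R d)).
Variables (h : Vec -> R) (dO : measure_display) (O : Vec -> measurableType dO).
Variable P : forall xi, probability (O xi) R.
Variables (W : forall xi, vertex -> O xi -> Vec)
  (T : forall xi, vertex -> O xi -> R) (K : forall xi, vertex -> O xi -> bool).
Hypothesis HC : cascade h P W T K.
Variables (xi : Vec) (xi0 : xi != 0).

Local Notation history := (branch W T (xi:=xi) [::] : O xi -> FamT).

Lemma measurable_branch v :
  measurable_fun setT (branch W T (xi:=xi) v : O xi -> FamT).
Proof.
apply: measurable_family => u; apply: measurable_fun_pair.
- exact: (cascade_measurable_W HC).
- exact: (cascade_measurable_T HC).
Qed.

Lemma exponential_prob_nonpos (r : R) : exponential_prob r `]-oo, 0%R] = 0%E.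
Proof.
rewrite /exponential_prob.
rewrite (ae_eq_integral_nonmeasurable (g := fun=> 0%E)) //; first exact: integral0.
exists [set 0]; split => //=; first exact: lebesgue_measure_set1.
move=> x /= H; apply: contrapT => x0; apply: H; rewrite in_itv /= => xle0.
rewrite lt0_exponential_pdf // lt_neqAle xle0 andbT; exact/eqP.
Qed.

(** The exponential law charges no nonpositive time, also at the degenerate rate 0
    that W_v = 0 would give. *)
Lemma cascade_times_gt0 : {ae P xi, forall omega, forall v, 0 < T v omega}.
Proof.
have H v : {ae P xi, forall omega, 0 < T v omega}.
  exists [set omega | T v omega <= 0].
  have E : [set omega | T v omega <= 0] = (@T xi v) @^-1` `]-oo, (0:R)].
    by apply/seteqP; split => omega /=; rewrite in_itv.
  split.
  - rewrite E.
    have := cascade_measurable_T HC xi0 v measurableT (measurable_itv `]-oo, (0:R)]).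
    by rewrite setTI.
  - have := cascade_offspring HC xi0 v measurableT (measurable_itv `]-oo, (0:R)]) measurableT.
    rewrite integral0_eq => [|omega _]; last by rewrite exponential_prob_nonpos mul0e.
    move=> H0; rewrite E; apply: (etrans _ H0); congr (P xi _); apply/seteqP.
    by split => omega /=; [move=> ?; split|case=> _ []].
  - by move=> omega /= /negP; rewrite -leNgt.
have : {ae P xi, forall omega, forall n : nat,
    if @unpickle vertex n is Some v then 0 < T v omega else true}.
  apply: ae_foralln => n; case: unpickle => [v|]; first exact: H.
  exact: aeW.
by apply: filterS => omega Homega v; have := Homega (pickle v); rewrite pickleK.
Qed.

Let coins (l : seq vertex) : set (O xi) := [set omega | all (fun v => K v omega) l].

Let all_coins_event (l : seq vertex) :
  family_events vertex _ bool [set kappa : vertex -> bool | all kappa l].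
Proof.
pose B := g_sigma_algebraType [set E : set (vertex -> bool) |
  exists i (B : set bool), measurable B /\ E = [set f | B (f i)] ].
suff : measurable_fun setT (fun kappa : B => all kappa l).
  by move=> /(_ measurableT [set true] I); rewrite setTI.
elim: l => [|v l IH] /=; first exact: measurable_cst.
apply: measurable_and => // _ Y mY; rewrite setTI.
by apply: sub_sigma_algebra; exists v, Y.
Qed.

Let measurable_coins l : measurable (coins l).
Proof.
suff : measurable_fun setT (fun omega : O xi => all (fun v => K v omega) l).
  by move=> /(_ measurableT [set true] I); rewrite setTI.
elim: l => [|v l IH] /=; first exact: measurable_cst.
by apply: measurable_and => //; exact: (cascade_measurable_K HC).
Qed.

Let coins_independent l (E : set FamT) : uniq l -> measurable E ->
  P xi (history @^-1` E `&` coins l) =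
  (((2^-1) ^+ size l)%:E * P xi (history @^-1` E))%E.
Proof.
move=> ul mE.
have -> : P xi (history @^-1` E `&` coins l) = _ :=
  cascade_thinning_independent_of_branching HC xi0 mE (all_coins_event l).
rewrite muleC; congr (_ * _)%E.
have := cascade_thinning_independent HC xi0 (fun=> true) ul.
rewrite (eq_bigr (fun=> (2^-1)%:E)) => [|v _]; last exact: (cascade_bernoulli HC).
rewrite prodEFin big_const_seq count_predT iter_mulr_1 => <-; congr (P xi _).
by apply/seteqP; split => omega /= /allP.
Qed.

Lemma integral_coins l (phi : FamT -> \bar R) : uniq l ->
  (forall x, 0 <= phi x)%E -> measurable_fun setT phi ->
  (\int[P xi]_omega ((\1_(coins l) omega)%:E * phi (history omega)) =
   ((2^-1) ^+ size l)%:E * \int[P xi]_omega phi (history omega))%E.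
Proof.
move=> ul phi0 mphi.
have mbr := measurable_branch [::].
have eval_is_functional (omega : O xi) :
    integration_functional (fun f : FamT -> \bar R => f (history omega)).
  by split.
have mix (wt : O xi -> R) : (forall omega, 0 <= wt omega) -> measurable_fun setT wt ->
    integration_functional (fun f : FamT -> \bar R =>
      \int[P xi]_omega ((wt omega)%:E * f (history omega)))%E.
  move=> wt0 mwt; apply: (@functional_mix _ _ _ _ _ (P xi) wt (fun omega f => f (history omega))) => //.
  by move=> f f0 mf; exact: (measurableT_comp mf mbr).
have c0 : 0 <= 2^-1 ^+ size l :> R by rewrite exprn_ge0 // invr_ge0.
rewrite -ge0_integralZl //; last exact: (measurableT_comp mphi mbr).
apply: (eq_functional (mix _ _ _) (mix (fun=> 2^-1 ^+ size l) _ _)) phi0 mphi => //.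
- move=> E mE.
  have mhE : measurable (history @^-1` E) by have := mbr measurableT E mE; rewrite setTI.
  have mi (F : set (O xi)) : measurable F -> measurable_fun setT (fun omega => (\1_F omega)%:E : \bar R).
    by move=> mF; apply/measurable_EFinP; exact: measurable_indic.
  rewrite ge0_integralZl //; last exact: (mi (history @^-1` E)).
  rewrite (integral_indic (P xi) measurableT mhE) setIT -coins_independent //.
  rewrite -[X in P xi X]setIT -integral_indic //.
  by apply: eq_integral => omega _; rewrite -EFinM !indicE in_setI -natrM mulnb andbC.
- by apply: measurableI => //; exact: measurable_coins.
Qed.

End thinning.

Section thinned_mean.
Context {R : realType} {d : nat}.
Local Notation Vec := 'rV[R]_d.
Local Notation Cvec := 'rV[R[i]]_d.
Local Notation FamT := (g_sigma_algebraType (@family_cylinders R d)).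
Variables (h : Vec -> R) (dO : measure_display) (O : Vec -> measurableType dO).
Variable P : forall xi, probability (O xi) R.
Variables (W : forall xi, vertex -> O xi -> Vec)
  (T : forall xi, vertex -> O xi -> R) (K : forall xi, vertex -> O xi -> bool).
Hypothesis HC : cascade h P W T K.
Variables (xi : Vec) (xi0 : xi != 0).
Variables (chi0 : Vec -> Cvec) (mchi0 : measurable_cvec_fun chi0).

Local Notation history := (branch W T (xi:=xi) [::] : O xi -> FamT).

Lemma minimal_cascade_ae t : {ae P xi, forall omega,
  minimal_cascade W T chi0 t omega = limit_value chi0 (history omega) t}.
Proof.
have := cascade_times_gt0 HC xi0; apply: filterS => omega T0.
have [[n Hn]|/forallNP Hn] := pselect (exists n, stops n (history omega) t).
  by rewrite (limit_value_stops chi0 Hn); exact: minimal_process_stops.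
rewrite limit_value_nonstop => [|n]; last exact/negP.
by apply: minimal_process_nonstop => // n; exact/negP.
Qed.

Variable t : R.

Let cell (p : nat * seq vertex) : set FamT :=
  [set x | [&& stops p.1.+1 x t, ~~ stops p.1 x t & branching_nodes p.1.+1 x t == p.2]].

Let cells k : set FamT := if pickle_inv k is Some p then cell p else set0.

Let cellsE k x : cells k x -> exists2 p, k = pickle p & cell p x.
Proof.
rewrite /cells; case E : (pickle_inv k) => [p|//] Hx; exists p => //.
by have := @pickle_invK (nat * seq vertex)%type k; rewrite E /= => ->.
Qed.

Let cell_cells p x : cell p x -> cells (pickle p) x.
Proof. by rewrite /cells pickleK_inv. Qed.

Let mat : measurable_fun setT (fun x : FamT => (x, t)).
Proof. by apply: measurable_fun_pair => //; exact: measurable_cst. Qed.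

Let measurable_stops_at n : measurable_fun setT (fun x : FamT => stops n x t).
Proof. exact: (measurableT_comp (measurable_stops n) mat). Qed.

Let measurable_cell p : measurable (cell p).
Proof.
rewrite (_ : cell p = (fun x : FamT => stops p.1.+1 x t) @^-1` [set true] `&`
  ((fun x : FamT => stops p.1 x t) @^-1` [set false] `&`
   (fun x : FamT => (x, t)) @^-1` [set q | branching_nodes p.1.+1 q.1 q.2 = p.2])).
  apply: measurableI; last apply: measurableI.
  - by have := measurable_stops_at p.1.+1 measurableT (Y := [set true]) I; rewrite setTI.
  - by have := measurable_stops_at p.1 measurableT (Y := [set false]) I; rewrite setTI.
  - by have := mat measurableT (@measurable_branching_nodes R d p.1.+1 p.2); rewrite setTI.
rewrite /cell; apply/seteqP; split => x /=.
  by move=> /and3P[-> /negbTE -> /eqP ->].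
by move=> [-> [-> ->]]; rewrite eqxx.
Qed.

Let measurable_cells k : measurable (cells k).
Proof. by rewrite /cells; case: pickle_inv. Qed.

Let stops_cell n x : stops n x t -> exists p, cell p x.
Proof.
move=> Hn; have ex : exists n, stops n x t by exists n.
case: (ex_minnP ex) => [[//|m]] Hm min.
exists (m, branching_nodes m.+1 x t); rewrite /cell /=.
apply/and3P; split => //; apply/negP => /min; by rewrite ltnn.
Qed.

Let cell_inj p q x : cell p x -> cell q x -> p = q.
Proof.
case: p q => [n l] [m l'] /and3P[/= Sn Nn /eqP Ln] /and3P[/= Sm Nm /eqP Lm].
have lt k k' : stops k.+1 x t -> ~~ stops k' x t -> (k' <= k)%N.
  move=> Sk; apply: contraR; rewrite -ltnNge => kk'.
  by have [] := stops_stable chi0 kk' Sk.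
have E : n = m by apply/eqP; rewrite eqn_leq (lt _ _ Sm Nn) (lt _ _ Sn Nm).
by rewrite E in Ln *; rewrite -Ln -Lm.
Qed.

(** Conditionally on the positions and the times, the thinned value is the
    non-thinned one times 2 to the number N of branchings if all N coins are
    favourable and 0 otherwise; that factor has mean 1. Nothing is lost when the
    non-thinned recursion does not terminate: the thinned one then terminates
    only through a killed vertex, hence with value 0. Cutting the sample space
    according to the list of branching vertices makes N and the relevant coins
    deterministic. *)
Lemma thinned_minimal_integral (f : Cvec -> R) :
  (forall a, 0 <= f a) ->
  (forall (k : R) a, 0 <= k -> f (k%:C%C *: a) = k * f a) ->
  (forall g : FamT -> Cvec, measurable_cvec g ->
    measurable_fun setT (fun x => f (g x))) ->
  (\int[P xi]_omega (f (thinned_cascade W T K chi0 t omega))%:E =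
   \int[P xi]_omega (f (minimal_cascade W T chi0 t omega))%:E)%E.
Proof.
move=> f_ge0 fZ mf.
have f0 : f 0 = 0 by rewrite -[0](scale0r 0) (fZ 0) // mul0r.
have mbr := measurable_branch HC xi0 [::].
have -> : (\int[P xi]_omega (f (minimal_cascade W T chi0 t omega))%:E =
    \int[P xi]_omega (f (limit_value chi0 (history omega) t))%:E)%E.
  apply: ae_eq_integral_nonmeasurable => //.
  by have := minimal_cascade_ae t; apply: filterS => omega ->.
pose F k := history @^-1` (cells k).
have mF k : measurable (F k).
  by have := mbr measurableT _ (measurable_cells k); rewrite setTI.
pose fT n x := (f (truncated chi0 n x t))%:E.
have mfT n : measurable_fun setT (fT n : FamT -> \bar R).
  by apply/measurable_EFinP; apply: mf; exact: measurable_truncated_at.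
pose ind l omega : R := \1_[set omega : O xi | all (fun v => K v omega) l] omega.
have thinnedE n l omega : cell (n, l) (history omega) ->
    (f (thinned_cascade W T K chi0 t omega))%:E =
    ((ind l omega)%:E * ((2 ^+ size l)%:E * fT n.+1 (history omega)))%E.
  move=> /and3P[/= Sn _ /eqP Ln]; rewrite /thinned_cascade.
  rewrite (@thinned_process_stops _ _ chi0 (fun v => W v omega) (fun v => T v omega)
    (fun v => K v omega) n.+1 t Sn).
  rewrite [branching_nodes _ _ _]Ln /thinning_weight /ind indicE /fT.
  have [al|nal] := boolP (all _ l).
    rewrite mem_set //= mul1e -EFinM -fZ ?exprn_ge0 //.
    by congr (f (_ *: _))%:E; rewrite rmorphXn /= rmorphMn.
  by rewrite scale0r f0 memNset ?mul0e //=; exact/negP.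
have limitE n l omega : cell (n, l) (history omega) ->
    (f (limit_value chi0 (history omega) t))%:E = fT n.+1 (history omega).
  by move=> /and3P[Sn _ _]; rewrite (limit_value_stops chi0 (n := n.+1) Sn).
have nocell omega : ~ (\bigcup_k F k) omega -> forall n, ~~ stops n (history omega) t.
  move=> H n; apply/negP => /stops_cell[p /cell_cells Hp]; apply: H.
  by exists (pickle p).
have Fcell k omega : F k omega -> exists2 p, k = pickle p & cell p (history omega).
  exact: cellsE.
have Fp p : F (pickle p) = history @^-1` cell p by rewrite /F /cells pickleK_inv.
have Fnone k : pickle_inv k = None :> option (nat * seq vertex) -> F k = set0.
  by rewrite /F /cells => ->; rewrite preimage_set0.
have mind l : measurable_fun setT (fun omega => (ind l omega)%:E).
  apply/measurable_EFinP; apply: measurable_indic.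
  have : measurable_fun setT (fun omega : O xi => all (fun v => K v omega) l).
    elim: l => [|v l IH] /=; first exact: measurable_cst.
    by apply: measurable_and => //; exact: (cascade_measurable_K HC).
  by move=> /(_ measurableT [set true] I); rewrite setTI.
have mthin k : measurable_fun (F k) (fun omega => (f (thinned_cascade W T K chi0 t omega))%:E).
  case E : (@pickle_inv (nat * seq vertex)%type k) => [[n l]|]; last first.
    by rewrite Fnone //; exact: measurable_fun_set0.
  have /= := @pickle_invK (nat * seq vertex)%type k; rewrite E /= => <-; rewrite Fp.
  apply: (eq_measurable_fun (fun omega => (ind l omega)%:E * ((2 ^+ size l)%:E * fT n.+1 (history omega)))%E).
    by move=> omega; rewrite inE => /thinnedE ->.
  apply: measurable_funTS; apply: emeasurable_funM => //.
  by apply: measurable_funeM; exact: (measurableT_comp (mfT n.+1) mbr).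
apply: (eq_integral_partition mF) => //.
- apply/trivIsetP => i j _ _ ij; apply/seteqP; split => // omega /= [/Fcell[p Ep Hp] /Fcell[q Eq Hq]].
  by move: ij; rewrite Ep Eq (cell_inj Hp Hq) eqxx.
- by move=> omega; rewrite lee_fin.
- by move=> omega; rewrite lee_fin.
- move=> k; apply: measurable_funTS.
  have ml : measurable_fun setT (fun x : FamT => (f (limit_value chi0 x t))%:E).
    by apply/measurable_EFinP; apply: mf; exact: measurable_limit_value.
  exact: (measurableT_comp ml mbr).
- move=> omega /nocell Hn; rewrite /thinned_cascade thinned_process_nonstop ?f0 //.
- by move=> omega /nocell Hn; rewrite limit_value_nonstop ?f0.
move=> k.
case E : (@pickle_inv (nat * seq vertex)%type k) => [[n l]|]; last first.
  by rewrite Fnone // !integral_set0.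
have /= := @pickle_invK (nat * seq vertex)%type k; rewrite E /= => <-; rewrite Fp.
pose phi := (fun x : FamT => (2 ^+ size l)%:E * fT n.+1 x)%E \_ (cell (n, l)).
have c0 : 0 <= 2 ^+ size l :> R by rewrite exprn_ge0.
have [->|/set0P[x0 Hx0]] := eqVneq (cell (n, l)) set0.
  by rewrite preimage_set0 !integral_set0.
have ul : uniq l by move: Hx0 => /and3P[_ _ /eqP El]; rewrite -[l]/((n, l).2) -El;
  exact: branching_nodes_uniq.
rewrite integral_mkcond [RHS]integral_mkcond.
transitivity (\int[P xi]_omega ((ind l omega)%:E * phi (history omega)))%E.
  apply: eq_integral => omega _; rewrite /phi !patchE.
  have [Hc|Hc] := pselect (cell (n, l) (history omega)).
    by rewrite !mem_set // (thinnedE _ _ _ Hc).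
  by rewrite !memNset // mule0.
have mphi : measurable_fun setT (phi : FamT -> \bar R).
  apply/(measurable_restrictT _ (measurable_cell (n, l))); apply: measurable_funTS.
  exact: measurable_funeM.
have fT0 x : (0 <= fT n.+1 x)%E by rewrite lee_fin.
have phi0 x : (0 <= phi x)%E.
  by rewrite /phi patchE; case: ifP => // _; rewrite mule_ge0.
apply: (etrans (integral_coins HC xi0 ul phi0 mphi)).
transitivity (\int[P xi]_omega (((2^-1) ^+ size l)%:E * phi (history omega)))%E.
  apply/esym/ge0_integralZl => [|||]; first exact: measurableT.
  - exact: (measurableT_comp mphi mbr).
  - by move=> omega _; exact: phi0.
  - by rewrite lee_fin exprn_ge0 // invr_ge0.
apply: eq_integral => omega _; rewrite /phi !patchE.
have [Hc|Hc] := pselect (cell (n, l) (history omega)); last by rewrite !memNset // mule0.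
by rewrite !mem_set // (limitE _ _ _ Hc) muleA -EFinM -exprMn mulVf ?expr1n ?mul1r.
Qed.

End thinned_mean.

Section coordinates.
Context {R : realType} {d : nat}.
Local Notation Vec := 'rV[R]_d.
Local Notation Cvec := 'rV[R[i]]_d.

(** The coordinates of C^d over the reals, in which the integrals are defined. *)
Definition real_coord (k : 'I_d * bool) (a : Cvec) : R :=
  if k.2 then complex.Re (a ord0 k.1) else complex.Im (a ord0 k.1).

Lemma eq_real_coord (a b : Cvec) :
  (forall k, real_coord k a = real_coord k b) -> a = b.
Proof.
move=> H; apply/rowP => j; have := H (j, true); have := H (j, false).
rewrite /real_coord /=; case: (a ord0 j) => ? ?; case: (b ord0 j) => ? ? /=.
by move=> -> ->.
Qed.

Lemma real_coordD k (a b : Cvec) :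
  real_coord k (a + b) = real_coord k a + real_coord k b.
Proof. by rewrite /real_coord; case: k.2; rewrite mxE ?ReD ?ImD. Qed.

Lemma real_coordZ k (r : R) (a : Cvec) :
  real_coord k (r%:C%C *: a) = r * real_coord k a.
Proof.
by rewrite /real_coord; case: k.2; rewrite mxE ?ReM ?ImM /= mul0r ?subr0 ?addr0.
Qed.

Lemma real_coord0 k : real_coord k (0 : Cvec) = 0.
Proof. by rewrite -[0](scale0r 0) (real_coordZ k 0) mul0r. Qed.

Lemma real_coordB k (a b : Cvec) :
  real_coord k (a - b) = real_coord k a - real_coord k b.
Proof.
have := real_coordD k (a - b) b; rewrite subrK => ->; by rewrite addrK.
Qed.

Lemma cnormE (a : Cvec) : cnorm a = Num.sqrt (\sum_k real_coord k a ^+ 2).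
Proof.
rewrite /cnorm; congr Num.sqrt.
rewrite (eq_bigr (fun j => \sum_(b : bool) real_coord (j, b) a ^+ 2)) => [|j _].
  by rewrite pair_big; apply: eq_bigr => -[].
by rewrite big_bool.
Qed.

Lemma cnorm_ge0 (a : Cvec) : 0 <= cnorm a.
Proof. exact: sqrtr_ge0. Qed.

Lemma real_coord_le_cnorm k (a : Cvec) : `|real_coord k a| <= cnorm a.
Proof.
rewrite cnormE -sqrtr_sqr ler_wsqrtr // (bigD1 k) //= lerDl.
by apply: sumr_ge0 => i _; exact: sqr_ge0.
Qed.

Lemma cnormZ (r : R) (a : Cvec) : 0 <= r -> cnorm (r%:C%C *: a) = r * cnorm a.
Proof.
move=> r0; rewrite !cnormE.
under eq_bigr do rewrite real_coordZ exprMn.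
by rewrite -mulr_sumr sqrtrM ?sqr_ge0 // sqrtr_sqr ger0_norm.
Qed.

Lemma cnorm0 : cnorm (0 : Cvec) = 0.
Proof. by rewrite -[0](scale0r 0) (cnormZ _ (lexx 0)) mul0r. Qed.

Lemma measurable_real_coord dS (S : measurableType dS) (f : S -> Cvec) k :
  measurable_cvec f -> measurable_fun setT (fun x => real_coord k (f x)).
Proof. by move=> mf; rewrite /real_coord; case: k.2; case: (mf k.1). Qed.

Lemma real_coord_integral dS (S : measurableType dS)
    (mu : {measure set S -> \bar R}) (D : set S) (f : S -> Cvec) k :
  real_coord k (cvec_integral mu D f) = \int[mu]_(x in D) real_coord k (f x).
Proof. by rewrite /real_coord /cvec_integral; case: k.2; rewrite mxE. Qed.

End coordinates.

Section thinned_equals_minimal.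
Context {R : realType} {d : nat}.
Local Notation Vec := 'rV[R]_d.
Local Notation Cvec := 'rV[R[i]]_d.
Variables (h : Vec -> R) (dO : measure_display) (O : Vec -> measurableType dO).
Variable P : forall xi, probability (O xi) R.
Variables (W : forall xi, vertex -> O xi -> Vec)
  (T : forall xi, vertex -> O xi -> R) (K : forall xi, vertex -> O xi -> bool).
Hypothesis HC : cascade h P W T K.
Variables (xi : Vec) (xi0 : xi != 0).
Variables (chi0 : Vec -> Cvec) (mchi0 : measurable_cvec_fun chi0).

Lemma mean_norm_thinned_minimal t :
  mean_norm P (thinned_cascade W T K chi0) xi t =
  mean_norm P (minimal_cascade W T chi0) xi t.
Proof.
apply: (thinned_minimal_integral HC xi0 mchi0 t) => [a|r a r0|g mg].
- exact: cnorm_ge0.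
- exact: cnormZ.
- exact: measurable_cnorm.
Qed.

(** The positive and the negative part of a coordinate are compared separately, so
    the equality holds also where the integrals diverge. *)
Lemma mean_thinned_minimal t :
  mean P (thinned_cascade W T K chi0) xi t =
  mean P (minimal_cascade W T chi0) xi t.
Proof.
apply: eq_real_coord => k; rewrite !real_coord_integral /Rintegral.
congr fine; rewrite integralE [RHS]integralE; congr (_ - _)%E.
- have pos a : maxe (real_coord k a)%:E 0 = (Num.max (real_coord k a) 0)%:E.
    by rewrite EFin_max.
  under eq_integral do rewrite funeposE pos.
  under [RHS]eq_integral do rewrite funeposE pos.
  apply: (thinned_minimal_integral HC xi0 mchi0 t
    (f := fun a => Num.max (real_coord k a) 0)) => [a|r a r0|g mg].
  + by rewrite le_max lexx orbT.
  + by rewrite real_coordZ maxr_pMr // mulr0.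
  + by apply: measurable_maxr => //; exact: measurable_real_coord.
- have neg a : maxe (- (real_coord k a)%:E)%E 0 = (Num.max (- real_coord k a) 0)%:E.
    by rewrite EFin_max.
  under eq_integral do rewrite funenegE neg.
  under [RHS]eq_integral do rewrite funenegE neg.
  apply: (thinned_minimal_integral HC xi0 mchi0 t
    (f := fun a => Num.max (- real_coord k a) 0)) => [a|r a r0|g mg].
  + by rewrite le_max lexx orbT.
  + by rewrite real_coordZ maxr_pMr // mulr0 mulrN.
  + apply: measurable_maxr => //; apply: measurable_funN.
    exact: measurable_real_coord.
Qed.

End thinned_equals_minimal.

(** * The law of a cascade as a probability kernel *)

Lemma integral_functional_measure {dT} {S : measurableType dT} {R : realType}
    (Phi : (S -> \bar R) -> \bar R) (HPhi : integration_functional Phi)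
    (f : S -> \bar R) : (forall x, 0 <= f x)%E -> measurable_fun setT f ->
  (\int[functional_measure HPhi]_x f x = Phi f)%E.
Proof.
apply: (eq_functional (integral_is_functional _) HPhi) => A mA.
by rewrite integral_indic // setIT /= functional_measureE.
Qed.

Section cascade_laws.
Context {R : realType} {d : nat}.
Local Notation Vec := 'rV[R]_d.
Local Notation Cvec := 'rV[R[i]]_d.
Local Notation FamT := (g_sigma_algebraType (@family_cylinders R d)).
Variables (h : Vec -> R) (dO : measure_display) (O : Vec -> measurableType dO).
Variable P : forall xi, probability (O xi) R.
Variables (W : forall xi, vertex -> O xi -> Vec)
  (T : forall xi, vertex -> O xi -> R) (K : forall xi, vertex -> O xi -> bool).
Hypothesis HC : cascade h P W T K.

(** At the origin, where nothing is known about the cascade, the law is replaced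
    by a unit mass; this makes it a probability kernel on the whole space. *)
Definition law_functional (eta : Vec) (f : FamT -> \bar R) : \bar R :=
  if eta == 0 then f (fun=> (0, 0))
  else (\int[P eta]_omega f (branch W T [::] omega))%E.

Lemma law_is_functional eta : integration_functional (law_functional eta).
Proof.
rewrite /law_functional; have [_|eta0] := eqVneq eta 0; first by split.
exact: (image_is_functional (P eta) (measurable_branch HC eta0 [::])).
Qed.

Definition law eta : set FamT -> \bar R := functional_measure (law_is_functional eta).

HB.instance Definition _ eta := Measure.on (law eta).

Lemma lawE eta A : measurable A -> eta != 0 -> law eta A = cascade_law P W T eta A.
Proof.
move=> mA eta0; rewrite /law functional_measureE // /law_functional (negbTE eta0).
exact: (image_functional_indic (P eta) (measurable_branch HC eta0 [::]) mA).
Qed.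

Lemma law_setT eta : law eta setT = 1%E.
Proof.
rewrite /law functional_measureE // /law_functional; case: ifP => _.
  by rewrite indicT.
transitivity (\int[P eta]_omega (cst 1%E omega))%E.
  by apply: eq_integral => omega _; rewrite indicT.
rewrite integral_cst // mul1e; exact: probability_setT.
Qed.

HB.instance Definition _ eta := @Measure_isProbability.Build _ _ R (law eta) (law_setT eta).

Lemma integral_law eta (f : FamT -> \bar R) : eta != 0 ->
  (forall x, 0 <= f x)%E -> measurable_fun setT f ->
  (\int[law eta]_x f x = \int[P eta]_omega f (branch W T [::] omega))%E.
Proof.
move=> eta0 f0 mf; rewrite (integral_functional_measure (law_is_functional eta)) //.
by rewrite /law_functional (negbTE eta0).
Qed.

Lemma measurable_law A : measurable A -> measurable_fun setT (fun eta => law eta A).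
Proof.
move=> mA.
have m0 : measurable [set (0 : Vec)] by exact: measurable_rV_set1.
have := cascade_law_measurable HC mA.
rewrite -(setUv [set (0 : Vec)]) => mlaw; apply/measurable_funU => //.
  exact: measurableC.
split; first exact: measurable_fun_set1.
apply: eq_measurable_fun mlaw => eta; rewrite inE /= => /eqP eta0.
by rewrite lawE.
Qed.

Section law_kernel.
Context dX (X : measurableType dX) (theta : X -> Vec).
Hypothesis mtheta : measurable_fun setT theta.

Definition law_kernel of measurable_fun setT theta :=
  fun x : X => law (theta x) : {measure set FamT -> \bar R}.

Let measurable_law_kernel U : measurable U ->
  measurable_fun setT (law_kernel mtheta ^~ U).
Proof. by move=> mU; exact: (measurableT_comp (measurable_law mU) mtheta). Qed.

HB.instance Definition _ := isKernel.Build _ _ X FamT R (law_kernel mtheta)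
  measurable_law_kernel.

Let law_kernel_setT x : law_kernel mtheta x setT = 1%E.
Proof. exact: law_setT. Qed.

HB.instance Definition _ := Kernel_isProbability.Build _ _ X FamT R
  (law_kernel mtheta) law_kernel_setT.

Lemma measurable_integral_law (k : X * FamT -> \bar R) :
  (forall z, 0 <= k z)%E -> measurable_fun setT k ->
  measurable_fun setT (fun x => \int[law (theta x)]_y k (x, y))%E.
Proof.
exact: (measurable_fun_integral_finite_kernel k (law_kernel mtheta)).
Qed.

End law_kernel.

Lemma measurable_integral_law2 dX (X : measurableType dX) (theta1 theta2 : X -> Vec)
    (k : X * (FamT * FamT) -> \bar R) :
  measurable_fun setT theta1 -> measurable_fun setT theta2 ->
  (forall z, 0 <= k z)%E -> measurable_fun setT k ->
  measurable_fun setT (fun x => \int[law (theta1 x) \x law (theta2 x)]_p k (x, p))%E.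
Proof.
move=> m1 m2 k0 mk.
pose g (z : X * FamT) := (\int[law (theta2 z.1)]_y k (z.1, (z.2, y)))%E.
have mg : measurable_fun setT g.
  apply: (@measurable_integral_law _ _ (fun z : X * FamT => theta2 z.1) _
    (fun z => k (z.1.1, (z.1.2, z.2)))) => //.
    exact: (measurableT_comp m2).
  apply: (measurableT_comp mk).
  apply: measurable_fun_pair; first exact: (measurableT_comp measurable_fst).
  by apply: measurable_fun_pair => //; exact: (measurableT_comp measurable_snd).
have -> : (fun x => \int[law (theta1 x) \x law (theta2 x)]_p k (x, p))%E =
    (fun x => \int[law (theta1 x)]_y g (x, y))%E.
  apply/funext => x; rewrite fubini_tonelli1 //.
  exact: (measurableT_comp mk (pair1_measurable x)).
apply: (measurable_integral_law m1) => // z; exact: integral_ge0.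
Qed.

End cascade_laws.

(** * The first branching *)

Section first_branching.
Context {R : realType} {d : nat}.
Local Notation Vec := 'rV[R]_d.
Local Notation Cvec := 'rV[R[i]]_d.
Local Notation FamT := (g_sigma_algebraType (@family_cylinders R d)).
Variables (d_gt0 : (0 < d)%N).
Variables (h : Vec -> R) (hh : majorizing_kernel h).
Variables (dO : measure_display) (O : Vec -> measurableType dO).
Variable P : forall xi, probability (O xi) R.
Variables (W : forall xi, vertex -> O xi -> Vec)
  (T : forall xi, vertex -> O xi -> R) (K : forall xi, vertex -> O xi -> bool).
Hypothesis HC : cascade h P W T K.
Variables (xi : Vec) (xi0 : xi != 0).
Local Notation leb := (@lebesgue_measure R).
Local Notation leb_d := (lebesgue_rV d).

Lemma enorm_gt0 (x : Vec) : x != 0 -> 0 < enorm x.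
Proof.
move=> x0; rewrite sqrtr_gt0 lt_neqAle eq_sym sumr_ge0 ?andbT; last first.
  by move=> j _; exact: sqr_ge0.
apply: contra x0; rewrite psumr_eq0 => [/allP H|j _]; last exact: sqr_ge0.
apply/eqP/rowP => j; rewrite mxE.
by have := H j (mem_index_enum _); rewrite sqrf_eq0 => /eqP.
Qed.

Lemma ae_neq (c : Vec) : {ae leb_d, forall eta, eta != c}.
Proof.
exists [set c]; split; first exact: measurable_rV_set1.
  exact: lebesgue_rV_set1.
by move=> x /= /negP/negPn/eqP.
Qed.

(** The value h 0 is arbitrary and may be negative; with 0 in its place the density
    of the first child is nonnegative and measurable everywhere, and it is the same
    density almost everywhere. *)
Definition punctured (k : Vec -> R) : Vec -> R := k \_ (~` [set 0]).

Lemma puncturedE (k : Vec -> R) eta : eta != 0 -> punctured k eta = k eta.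
Proof. by move=> /eqP eta0; rewrite /punctured patchE mem_set. Qed.

Lemma punctured_ge0 eta : 0 <= punctured h eta.
Proof.
rewrite /punctured patchE; case: ifPn => //; rewrite inE /= => /eqP eta0.
exact/ltW/(majorizing_gt0 hh).
Qed.

Let measurable_punctured : measurable_fun setT (punctured h).
Proof.
apply/(measurable_restrictT _ _).1; last exact: (majorizing_measurable hh).
by apply: measurableC; exact: measurable_rV_set1.
Qed.

Definition offspring_density (eta : Vec) : R := branching_density (punctured h) eta xi.

Lemma offspring_density_ge0 eta : 0 <= offspring_density eta.
Proof.
by rewrite /offspring_density /branching_density divr_ge0 ?mulr_ge0 ?punctured_ge0 //;
  exact: sqrtr_ge0.
Qed.

Lemma measurable_offspring_density : measurable_fun setT offspring_density.
Proof.
apply: measurable_funM => //; apply: measurable_funM => //.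
exact: (measurableT_comp measurable_punctured (measurable_rV_reflect xi)).
Qed.

Lemma offspring_densityE eta : eta != 0 -> eta != xi ->
  offspring_density eta = branching_density h eta xi.
Proof.
move=> eta0 etaxi; rewrite /offspring_density /branching_density !puncturedE //.
by rewrite subr_eq0 eq_sym.
Qed.

Lemma offspring_density_ae :
  {ae leb_d, forall eta, offspring_density eta = branching_density h eta xi}.
Proof.
have := ae_neq 0; have := ae_neq xi; apply: filterS2 => eta etaxi eta0; exact: offspring_densityE.
Qed.

Local Notation rate := (enorm xi ^+ 2).

Lemma root_offspring (A : set R) (C : set Vec) : measurable A -> measurable C ->
  P xi [set omega | A (T [::] omega) /\ C (W [:: false] omega)] =
  (exponential_prob rate A * \int[leb_d]_(eta in C) (offspring_density eta)%:E)%E.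
Proof.
move=> mA mC.
have := cascade_offspring HC xi0 [::] measurableT mA mC.
rewrite (_ : [set omega | _] = [set omega | A (T [::] omega) /\ C (W [:: false] omega)]); last first.
  by apply/seteqP; split => omega /=; [case=> _|].
move=> ->.
rewrite (_ : [set omega | _] = setT); last by apply/seteqP; split.
transitivity (\int[P xi]_omega (cst (exponential_prob rate A *
    \int[leb_d]_(eta in C) (offspring_density eta)%:E) omega))%E; last first.
  by rewrite integral_cst // [X in (_ * X)%E]probability_setT mule1.
apply: ae_eq_integral_nonmeasurable => //.
have := cascade_root HC xi0; apply: filterS => omega -> _ /=; congr (_ * _)%E.
apply: ae_eq_integral_nonmeasurable => //.
by have := offspring_density_ae; apply: filterS => eta ->.
Qed.

Lemma rate_gt0 : 0 < rate.
Proof. by rewrite exprn_gt0 // enorm_gt0. Qed.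

Lemma integral_offspring_density :
  (\int[leb_d]_eta (offspring_density eta)%:E = 1)%E.
Proof.
have := root_offspring measurableT measurableT.
rewrite (_ : [set omega | _] = setT); last by apply/seteqP; split.
rewrite probability_setT.
by rewrite [exponential_prob _ _]integral_exponential_pdf ?rate_gt0 // mul1e => <-.
Qed.

Lemma exponential_prob_fin_num A : measurable A -> exponential_prob rate A \is a fin_num.
Proof.
move=> mA; have pdf0 x := exponential_pdf_ge0 (ltW rate_gt0) x.
have mpdf : measurable_fun setT (EFin \o exponential_pdf rate).
  by apply/measurable_EFinP; exact: measurable_exponential_pdf.
rewrite ge0_fin_numE; last by apply: integral_ge0 => x _; rewrite lee_fin.
apply: (@le_lt_trans _ _ (exponential_prob rate setT)).
  by apply: ge0_subset_integral => // x _; rewrite lee_fin.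
by rewrite [exponential_prob _ _]integral_exponential_pdf ?rate_gt0 // ltry.
Qed.

Let event_is_functional dS (S : measurableType dS) dS' (S' : measurableType dS')
    (mu : {measure set S -> \bar R}) (theta : S -> S') (wt : S -> R) :
  measurable_fun setT theta -> (forall s, 0 <= wt s) -> measurable_fun setT wt ->
  integration_functional (fun f : S' -> \bar R =>
    \int[mu]_s ((wt s)%:E * f (theta s)))%E.
Proof.
move=> mt wt0 mwt.
apply: (@functional_mix _ _ _ _ _ mu wt (fun s f => f (theta s))) => //.
by move=> f f0 mf; exact: (measurableT_comp mf mt).
Qed.

(** Both sides are integration functionals of psi which agree on indicators. *)
Lemma integral_root_offspring (A : set R) (psi : Vec -> \bar R) : measurable A ->
  (forall eta, 0 <= psi eta)%E -> measurable_fun setT psi ->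
  (\int[P xi]_omega ((\1_A (T [::] omega))%:E * psi (W [:: false] omega)) =
   exponential_prob rate A * \int[leb_d]_eta ((offspring_density eta)%:E * psi eta))%E.
Proof.
move=> mA psi0 mpsi.
have finA := exponential_prob_fin_num mA.
have pA0 : (0 <= exponential_prob rate A)%E.
  by apply: integral_ge0 => x _; rewrite lee_fin exponential_pdf_ge0 // ltW // rate_gt0.
have pA0' : 0 <= fine (exponential_prob rate A) by exact: fine_ge0.
rewrite -(fineK finA) -ge0_integralZl_EFin //; last 2 first.
- by move=> eta _; rewrite mule_ge0 // lee_fin offspring_density_ge0.
- apply: emeasurable_funM => //; apply/measurable_EFinP.
  exact: measurable_offspring_density.
under [RHS]eq_integral do rewrite muleA -EFinM.
have mW := cascade_measurable_W HC xi0 [:: false].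
have mT := cascade_measurable_T HC xi0 [::].
have mTA : measurable (@T xi [::] @^-1` A) by have := mT measurableT A mA; rewrite setTI.
have HF1 : integration_functional (fun f : Vec -> \bar R =>
    \int[P xi]_omega ((\1_A (T [::] omega))%:E * f (W [:: false] omega)))%E.
  apply: (event_is_functional (P xi) (wt := fun omega => \1_A (T [::] omega)) mW) => //.
  exact: (measurableT_comp (measurable_indic mA) mT).
have HF2 : integration_functional (fun f : Vec -> \bar R =>
    \int[leb_d]_eta ((fine (exponential_prob rate A) * offspring_density eta)%:E * f eta))%E.
  apply: (event_is_functional leb_d (theta := id)
    (wt := fun eta => fine (exponential_prob rate A) * offspring_density eta)) => //.
  - by move=> eta; rewrite mulr_ge0 // offspring_density_ge0.
  - by apply: measurable_funM => //; exact: measurable_offspring_density.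
apply: (eq_functional HF1 HF2) psi0 mpsi => C mC.
have mWC : measurable (@W xi [:: false] @^-1` C) by have := mW measurableT C mC; rewrite setTI.
transitivity (P xi [set omega | A (T [::] omega) /\ C (W [:: false] omega)]).
  rewrite -[X in P xi X]setIT -integral_indic //; last exact: measurableI.
  apply: eq_integral => omega _; rewrite -EFinM !indicE -natrM mulnb.
  by congr ((nat_of_bool _)%:R%:E); apply/andP/idP; rewrite !inE.
rewrite root_offspring // integral_mkcond -{1}(fineK finA) -ge0_integralZl_EFin //.
+ apply: eq_integral => eta _; rewrite patchE EFinM -muleA; congr (_ * _)%E.
  rewrite indicE; case: ifP => _; by rewrite ?mule1 ?mule0.
+ by move=> eta _; rewrite patchE; case: ifP => // _; rewrite lee_fin offspring_density_ge0.
+ apply/(measurable_restrictT _ mC); apply: measurable_funTS; apply/measurable_EFinP.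
  exact: measurable_offspring_density.
Qed.

(** The laws of the cascades started at the two children are only known away from
    the origin, that is when W_1 is neither 0 nor xi. *)
Lemma child_neq0_ae : {ae P xi, forall omega, W [:: false] omega != 0 /\ W [:: false] omega != xi}.
Proof.
have H (c : Vec) : {ae P xi, forall omega, W [:: false] omega != c}.
  have mW := cascade_measurable_W HC xi0 [:: false].
  exists (@W xi [:: false] @^-1` [set c]); split.
  - by have := mW measurableT _ (measurable_rV_set1 c); rewrite setTI.
  - have := root_offspring measurableT (measurable_rV_set1 c).
    rewrite (_ : [set omega | _] = @W xi [:: false] @^-1` [set c]); last first.
      by apply/seteqP; split => omega /=; [case|].
    move=> ->; rewrite (ae_eq_integral_nonmeasurable (g := fun=> 0%E)).
    + by rewrite integral0 mule0.
    + exact: measurable_rV_set1.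
    + have := ae_neq c; apply: filterS => eta /eqP etac Hc; exfalso; exact: etac.
  - by move=> omega /= /negP/negPn/eqP.
have := H 0; have := H xi; apply: filterS2 => omega; by split.
Qed.

Lemma children_sum_ae : {ae P xi, forall omega, W [:: true] omega = xi - W [:: false] omega}.
Proof.
have := cascade_root HC xi0; have := cascade_conservation HC xi0 [::].
by apply: filterS2 => omega /= -> ->.
Qed.

End first_branching.

Section first_branching_law.
Context {R : realType} {d : nat}.
Local Notation Vec := 'rV[R]_d.
Local Notation Cvec := 'rV[R[i]]_d.
Local Notation FamT := (g_sigma_algebraType (@family_cylinders R d)).
Variables (d_gt0 : (0 < d)%N).
Variables (h : Vec -> R) (hh : majorizing_kernel h).
Variables (dO : measure_display) (O : Vec -> measurableType dO).
Variable P : forall xi, probability (O xi) R.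
Variables (W : forall xi, vertex -> O xi -> Vec)
  (T : forall xi, vertex -> O xi -> R) (K : forall xi, vertex -> O xi -> bool).
Hypothesis HC : cascade h P W T K.
Variables (xi : Vec) (xi0 : xi != 0).
Local Notation leb := (@lebesgue_measure R).
Local Notation leb_d := (lebesgue_rV d).
Local Notation rate := (enorm xi ^+ 2).
Local Notation dens := (offspring_density h xi).
Local Notation child_law eta := (law HC eta \x law HC (xi - eta))%E.

Definition first_branching_weight (q : R * Vec) : R :=
  exponential_pdf rate q.1 * dens q.2.

Lemma first_branching_weight_ge0 q : 0 <= first_branching_weight q.
Proof.
rewrite mulr_ge0 ?offspring_density_ge0 // exponential_pdf_ge0 // ltW //.
exact: rate_gt0.
Qed.

Lemma measurable_first_branching_weight : measurable_fun setT first_branching_weight.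
Proof.
apply: measurable_funM.
  exact: (measurableT_comp (measurable_exponential_pdf _) measurable_fst).
exact: (measurableT_comp (measurable_offspring_density hh xi) measurable_snd).
Qed.

Lemma measurable_integral_child_law (f : R * (FamT * FamT) -> \bar R) :
  (forall x, 0 <= f x)%E -> measurable_fun setT f ->
  measurable_fun setT (fun q : R * Vec => \int[child_law q.2]_p f (q.1, p))%E.
Proof.
move=> f0 mf.
apply: (@measurable_integral_law2 _ _ _ _ _ _ _ _ _ HC _ (R * Vec)%type snd
  (fun q => xi - q.2) (fun z => f (z.1.1, z.2))) => //.
- exact: (measurableT_comp (measurable_rV_reflect xi) measurable_snd).
- apply: (measurableT_comp mf); apply: measurable_fun_pair => //.
  exact: (measurableT_comp measurable_fst).
Qed.

Let mix_is_functional : integration_functional (fun f : R * (FamT * FamT) -> \bar R =>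
  \int[leb \x leb_d]_q ((first_branching_weight q)%:E *
     \int[child_law q.2]_p f (q.1, p)))%E.
Proof.
apply: (@functional_mix _ _ _ (R * (FamT * FamT))%type _ (leb \x leb_d)%E
  first_branching_weight (fun q f => \int[child_law q.2]_p f (q.1, p))%E).
- exact: first_branching_weight_ge0.
- exact: measurable_first_branching_weight.
- move=> [s eta].
  have mp : measurable_fun setT (pair (s : R) : FamT * FamT -> R * (FamT * FamT)).
    exact: pair1_measurable.
  exact: (functional_comp mp (integral_is_functional (child_law eta))).
- exact: measurable_integral_child_law.
Qed.

Let children : O xi -> R * (FamT * FamT) :=
  fun omega => (T [::] omega, (branch W T [:: false] omega, branch W T [:: true] omega)).

Let measurable_children : measurable_fun setT children.
Proof.
apply: measurable_fun_pair; first exact: (cascade_measurable_T HC).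
by apply: measurable_fun_pair; exact: (measurable_branch HC xi0).
Qed.

Let psi (B C : set FamT) (eta : Vec) : \bar R := (law HC eta B * law HC (xi - eta) C)%E.

Let psi_ge0 B C eta : (0 <= psi B C eta)%E.
Proof. by rewrite mule_ge0. Qed.

Let measurable_psi B C : measurable B -> measurable C -> measurable_fun setT (psi B C).
Proof.
move=> mB mC; apply: emeasurable_funM; first exact: measurable_law.
exact: (measurableT_comp (measurable_law HC mC) (measurable_rV_reflect xi)).
Qed.

Let children_rectangle (A : set R) (B C : set FamT) :
  measurable A -> measurable B -> measurable C ->
  P xi (children @^-1` (A `*` (B `*` C))) =
  (exponential_prob rate A * \int[leb_d]_eta ((dens eta)%:E * psi B C eta))%E.
Proof.
move=> mA mB mC.
have /= HF := cascade_branching HC xi0 [::] mA (@measurableT _ (Vec * Vec)%type) mB mC.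
apply: (etrans (etrans _ HF)).
  congr (P xi _); apply/seteqP; split => omega /=.
    by move=> [TA [HB HCC]]; split.
  by move=> [[TA _] [HB HCC]]; split.
rewrite -(integral_root_offspring d_gt0 hh HC xi0 mA (psi_ge0 B C)); last exact: measurable_psi.
rewrite integral_mkcond; apply: ae_eq_integral_nonmeasurable => //.
have := children_sum_ae HC xi0; have := child_neq0_ae d_gt0 HC xi0.
apply: filterS2 => omega [w0 wxi] w2 _; rewrite patchE indicE.
have [AT|AT] := pselect (A (T [::] omega)); last first.
  by rewrite !memNset // ?mul0e // => -[].
rewrite !mem_set // mul1e /psi !lawE //; last by rewrite subr_eq0 eq_sym.
by rewrite /child2 /= w2.
Qed.

Let mix_rectangle (A : set R) (B C : set FamT) :
  measurable A -> measurable B -> measurable C ->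
  (\int[leb \x leb_d]_q ((first_branching_weight q)%:E *
     \int[child_law q.2]_p (\1_A q.1 * (\1_B p.1 * \1_C p.2))%:E))%E =
  (exponential_prob rate A * \int[leb_d]_eta ((dens eta)%:E * psi B C eta))%E.
Proof.
move=> mA mB mC.
have pdf0 s : 0 <= exponential_pdf rate s by apply: exponential_pdf_ge0; exact/ltW/rate_gt0.
have dens0 eta := offspring_density_ge0 hh xi eta.
transitivity (\int[leb \x leb_d]_q ((exponential_pdf rate q.1 * \1_A q.1)%:E *
    ((dens q.2)%:E * psi B C q.2)))%E.
  apply: eq_integral => q _; rewrite /first_branching_weight (EFinM (exponential_pdf _ _) (dens _)).
  rewrite (EFinM (exponential_pdf _ _) (\1_A _)) -!muleA.
  congr (_ * _)%E; rewrite muleCA; congr (_ * _)%E.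
  transitivity (\int[child_law q.2]_p ((\1_A q.1)%:E * (\1_(B `*` C) p)%:E))%E.
    apply: eq_integral => -[x y] _; rewrite -EFinM; congr ((_ * _)%:E).
    by rewrite !indicE in_setX /= -natrM mulnb.
  rewrite ge0_integralZl_EFin //; last 1 first.
  - by apply/measurable_EFinP; apply: measurable_indic; exact: measurableX.
  congr (_ * _)%E; rewrite integral_indic //; last exact: measurableX.
  by rewrite setIT; exact: product_measure1E.
have mden : measurable_fun setT (fun eta => (dens eta)%:E * psi B C eta)%E.
  apply: emeasurable_funM; last exact: measurable_psi.
  by apply/measurable_EFinP; exact: measurable_offspring_density.
have mpdf : measurable_fun setT (fun s : R => (exponential_pdf rate s * \1_A s)%:E).
  apply/measurable_EFinP; apply: measurable_funM; last exact: measurable_indic.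
  exact: measurable_exponential_pdf.
rewrite fubini_tonelli1; last 2 first.
- by apply: emeasurable_funM; [exact: (measurableT_comp mpdf measurable_fst)
                              |exact: (measurableT_comp mden measurable_snd)].
- by move=> q; rewrite mule_ge0 // ?lee_fin ?mulr_ge0 // mule_ge0 // lee_fin.
rewrite /fubini_F /=.
transitivity (\int[leb]_s ((exponential_pdf rate s * \1_A s)%:E *
   \int[leb_d]_eta ((dens eta)%:E * psi B C eta)))%E.
  apply: eq_integral => s _; rewrite ge0_integralZl_EFin //.
  - by move=> eta _; rewrite mule_ge0 // lee_fin.
  - by rewrite mulr_ge0.
rewrite ge0_integralZr //; last 2 first.
- by move=> s _; rewrite lee_fin mulr_ge0.
- by apply: integral_ge0 => eta _; rewrite mule_ge0 // lee_fin.
congr (_ * _)%E; rewrite /exponential_prob [RHS]integral_mkcond.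
apply: eq_integral => s _; rewrite patchE indicE.
by case: (s \in A); rewrite ?mulr1 ?mulr0.
Qed.

(** One step of the branching, in integrated form: the first time and the first
    child have density exponential times H, and conditionally on them the two
    subfamilies are independent cascades. *)
Lemma first_branching_integral (f : R * (FamT * FamT) -> \bar R) :
  (forall x, 0 <= f x)%E -> measurable_fun setT f ->
  (\int[P xi]_omega f (T [::] omega,
     (branch W T [:: false] omega, branch W T [:: true] omega)) =
   \int[leb \x leb_d]_q ((first_branching_weight q)%:E *
     \int[child_law q.2]_p f (q.1, p)))%E.
Proof.
apply: (eq_functional_prod3 (image_is_functional (P xi) measurable_children)
  mix_is_functional).
- move=> A B C mA mB mC; rewrite mix_rectangle // -children_rectangle //.
  rewrite -(image_functional_indic (P xi) measurable_children); last first.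
    by apply: measurableX => //; exact: measurableX.
  apply: eq_integral => omega _; rewrite !indicE !in_setX /=.
  by rewrite -!natrM !mulnb.
- rewrite /image_functional integral_cst // mul1e.
  by rewrite [X in (X < _)%E]probability_setT ltry.
Qed.

End first_branching_law.

(** * Means of bilinear expressions *)

Section product_expectation.
Context {R : realType}.

Lemma integral_product_functions dS1 (S1 : measurableType dS1) dS2 (S2 : measurableType dS2)
    (m1 : {sigma_finite_measure set S1 -> \bar R})
    (m2 : {sigma_finite_measure set S2 -> \bar R})
    (f1 : S1 -> R) (f2 : S2 -> R) :
  m1.-integrable setT (EFin \o f1) -> m2.-integrable setT (EFin \o f2) ->
  (m1 \x m2)%E.-integrable setT (fun p => (f1 p.1 * f2 p.2)%:E) /\
  (\int[m1 \x m2]_p (f1 p.1 * f2 p.2)%:E =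
   \int[m1]_x (f1 x)%:E * \int[m2]_y (f2 y)%:E)%E.
Proof.
move=> i1 i2.
have m1f : measurable_fun setT f1 by apply/measurable_EFinP; exact: (measurable_int _ i1).
have m2f : measurable_fun setT f2 by apply/measurable_EFinP; exact: (measurable_int _ i2).
have mf : measurable_fun setT (fun p : S1 * S2 => (f1 p.1 * f2 p.2)%:E).
  apply/measurable_EFinP; apply: measurable_funM.
    exact: (measurableT_comp m1f measurable_fst).
  exact: (measurableT_comp m2f measurable_snd).
have intf : (m1 \x m2)%E.-integrable setT (fun p => (f1 p.1 * f2 p.2)%:E).
  apply/(integrable12ltyP _ _ mf).
  have /integrableP[_ a1] := i1; have /integrableP[_ a2] := i2.
  have n1 : measurable_fun setT (fun x => `|(f1 x)%:E|%E).
    by apply: measurableT_comp => //; exact/measurable_EFinP.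
  have n2 : measurable_fun setT (fun x => `|(f2 x)%:E|%E).
    by apply: measurableT_comp => //; exact/measurable_EFinP.
  have -> : (\int[m1]_x \int[m2]_y `|(f1 x * f2 y)%:E| =
      \int[m1]_x (`|(f1 x)%:E| * \int[m2]_y `|(f2 y)%:E|))%E.
    apply: eq_integral => x _; rewrite -ge0_integralZl //.
    by apply: eq_integral => y _; rewrite EFinM abseM.
  rewrite ge0_integralZr //; last by apply: integral_ge0.
  apply: lte_mul_pinfty => //; first exact: integral_ge0.
  by rewrite ge0_fin_numE //; exact: integral_ge0.
split=> //; rewrite -integral12_prod_meas1 //.
rewrite /fubini_F /=.
transitivity (\int[m1]_x ((f1 x)%:E * \int[m2]_y (f2 y)%:E))%E.
  apply: eq_integral => x _; rewrite -integralZl //.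
have /fineK <- : (\int[m2]_y (f2 y)%:E \is a fin_num)%E.
  exact: (integrable_fin_num measurableT i2).
exact: (integralZr measurableT i1).
Qed.

Context {d : nat}.
Local Notation Cvec := 'rV[R[i]]_d.

Lemma integrable_real_coord dS (S : measurableType dS) (mu : {measure set S -> \bar R})
    (f : S -> Cvec) k : measurable_cvec f -> (\int[mu]_x (cnorm (f x))%:E < +oo)%E ->
  mu.-integrable setT (fun x => (real_coord k (f x))%:E).
Proof.
move=> mf foo; apply: (@le_integrable _ _ _ _ _ _ _ (fun x => (cnorm (f x))%:E)) => //.
- by apply/measurable_EFinP; exact: measurable_real_coord.
- by move=> x _ /=; rewrite lee_fin (ger0_norm (cnorm_ge0 _)) real_coord_le_cnorm.
- apply/integrableP; split; first by apply/measurable_EFinP; exact: measurable_cnorm.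
  by under eq_integral do rewrite gee0_abs ?lee_fin ?cnorm_ge0 //.
Qed.

Definition real_basis (k : 'I_d * bool) : Cvec :=
  (if k.2 then 1 else 'i%C) *: delta_mx ord0 k.1.

Lemma real_basis_expansion (a : Cvec) :
  a = \sum_k (real_coord k a)%:C%C *: real_basis k.
Proof.
transitivity (\sum_j ((real_coord (j, true) a)%:C%C *: real_basis (j, true) +
                      (real_coord (j, false) a)%:C%C *: real_basis (j, false))).
  apply/rowP => j; rewrite summxE (bigD1 j) //= big1 ?addr0 => [|i ij].
    rewrite !mxE /real_coord /= eqxx !mulr1.
    by rewrite [LHS]complexE; congr (_ + _); rewrite mulrC.
  by rewrite !mxE (eq_sym j) (negbTE ij) /= !mulr0 addr0.
rewrite (eq_bigr (fun j => \sum_(b : bool) (real_coord (j, b) a)%:C%C *: real_basis (j, b))).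
  by rewrite pair_big; apply: eq_bigr => -[].
by move=> j _; rewrite big_bool.
Qed.

Section bilinear.
Variable B : Cvec -> Cvec -> R.
Hypothesis BDl : forall a a' b, B (a + a') b = B a b + B a' b.
Hypothesis BDr : forall a b b', B a (b + b') = B a b + B a b'.
Hypothesis BZl : forall (r : R) a b, B (r%:C%C *: a) b = r * B a b.
Hypothesis BZr : forall (r : R) a b, B a (r%:C%C *: b) = r * B a b.

Lemma real_bilinear_expansion a b :
  B a b = \sum_k \sum_l B (real_basis k) (real_basis l) *
    (real_coord k a * real_coord l b).
Proof.
have B0l b' : B 0 b' = 0 by rewrite -[0](scale0r 0) (BZl 0) mul0r.
have B0r a' : B a' 0 = 0 by rewrite -[0](scale0r 0) (BZr 0) mul0r.
rewrite {1}(real_basis_expansion a) (big_morph (B^~ b) (fun _ _ => BDl _ _ _) (B0l b)).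
apply: eq_bigr => k _.
rewrite {1}(real_basis_expansion b) (big_morph (B _) (BDr _) (B0r _)).
by apply: eq_bigr => l _; rewrite BZl BZr mulrA mulrC.
Qed.

(** In real coordinates a bilinear form is a finite combination of products of one
    function of each variable, so no estimate of the form is needed. *)
Lemma integral_bilinear dS1 (S1 : measurableType dS1) dS2 (S2 : measurableType dS2)
    (m1 : {sigma_finite_measure set S1 -> \bar R})
    (m2 : {sigma_finite_measure set S2 -> \bar R})
    (a : S1 -> Cvec) (b : S2 -> Cvec) :
  measurable_cvec a -> measurable_cvec b ->
  (\int[m1]_x (cnorm (a x))%:E < +oo)%E -> (\int[m2]_y (cnorm (b y))%:E < +oo)%E ->
  (m1 \x m2)%E.-integrable setT (fun p => (B (a p.1) (b p.2))%:E) /\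
  (\int[m1 \x m2]_p (B (a p.1) (b p.2))%:E =
   (B (cvec_integral m1 setT a) (cvec_integral m2 setT b))%:E)%E.
Proof.
move=> ma mb ia ib.
have ca k := integrable_real_coord k ma ia.
have cb k := integrable_real_coord k mb ib.
pose term k l (p : S1 * S2) := ((B (real_basis k) (real_basis l))%:E *
  (real_coord k (a p.1) * real_coord l (b p.2))%:E)%E.
have E : (fun p : S1 * S2 => (B (a p.1) (b p.2))%:E) =
    (fun p => \sum_k \sum_l term k l p)%E.
  apply/funext => p; rewrite real_bilinear_expansion -sumEFin.
  by apply: eq_bigr => k _; rewrite -sumEFin; apply: eq_bigr => l _; rewrite EFinM.
have iterm k l : (m1 \x m2)%E.-integrable setT (term k l).
  by apply: integrableZl => //; have [] := integral_product_functions (ca k) (cb l).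
have isum k : (m1 \x m2)%E.-integrable setT (fun p => \sum_l term k l p)%E.
  exact: integrable_sum.
split; first by rewrite E; exact: integrable_sum.
rewrite E integral_sum //.
rewrite real_bilinear_expansion -sumEFin; apply: eq_bigr => k _.
rewrite integral_sum // -sumEFin; apply: eq_bigr => l _.
have [ikl Ekl] := integral_product_functions (ca k) (cb l).
rewrite /term integralZl // Ekl EFinM; congr (_ * _)%E.
rewrite EFinM !real_coord_integral /Rintegral !fineK //.
- exact: (integrable_fin_num measurableT (cb l)).
- exact: (integrable_fin_num measurableT (ca k)).
Qed.

End bilinear.

Lemma integral_odot (xi : 'rV[R]_d) k
    dS1 (S1 : measurableType dS1) dS2 (S2 : measurableType dS2)
    (m1 : {sigma_finite_measure set S1 -> \bar R})
    (m2 : {sigma_finite_measure set S2 -> \bar R})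
    (a : S1 -> Cvec) (b : S2 -> Cvec) :
  measurable_cvec a -> measurable_cvec b ->
  (\int[m1]_x (cnorm (a x))%:E < +oo)%E -> (\int[m2]_y (cnorm (b y))%:E < +oo)%E ->
  (m1 \x m2)%E.-integrable setT (fun p => (real_coord k (odot xi (a p.1) (b p.2)))%:E) /\
  (\int[m1 \x m2]_p (real_coord k (odot xi (a p.1) (b p.2)))%:E =
   (real_coord k (odot xi (cvec_integral m1 setT a) (cvec_integral m2 setT b)))%:E)%E.
Proof.
apply: (@integral_bilinear (fun a b => real_coord k (odot xi a b))).
- by move=> *; rewrite odotDl real_coordD.
- by move=> *; rewrite odotDr real_coordD.
- by move=> *; rewrite odotZl real_coordZ.
- by move=> *; rewrite odotZr real_coordZ.
Qed.

End product_expectation.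

(** * One step of the Picard iteration *)

Section exponential_tail.
Context {R : realType}.

(** The half line and the complement of [0, t] differ by the point t and by negative
    numbers, where the density is 0. *)
Lemma exponential_prob_itvcy (r t : R) : 0 < r -> 0 < t ->
  exponential_prob r `[t, +oo[ = (expR (- t * r))%:E.
Proof.
move=> r0 t0.
have pdf0 x := exponential_pdf_ge0 (ltW r0) x.
have mpdf : measurable_fun setT (EFin \o exponential_pdf r).
  by apply/measurable_EFinP; exact: measurable_exponential_pdf.
have -> : exponential_prob r `[t, +oo[ = exponential_prob r (~` `[0, t]).
  rewrite /exponential_prob integral_mkcond [RHS]integral_mkcond.
  apply: ae_eq_integral_nonmeasurable => //.
  exists [set t]; split => //=; first exact: lebesgue_measure_set1.
  move=> x /= H; apply: contrapT => xt; apply: H => _; rewrite !patchE.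
  have [x0|x0] := ltP x 0.
    by rewrite lt0_exponential_pdf //; case: ifP => _; case: ifP.
  congr (if _ then _ else _); apply/idP/idP; rewrite !inE /= !in_itv /= andbT.
    move=> tx /andP[_ xlet]; apply: xt; apply/eqP; by rewrite eq_le tx xlet.
  by move/negP; rewrite x0 /= -ltNge => /ltW.
have : (exponential_prob r `[0%R, t] + exponential_prob r (~` `[0%R, t]) = 1)%E.
  rewrite -[RHS](integral_exponential_pdf r0) /exponential_prob.
  rewrite -ge0_integral_setU //.
  - by rewrite setUv.
  - exact: measurableC.
  - by rewrite setUv.
  - by move=> x _; rewrite lee_fin.
  - exact/disj_setPCl.
rewrite exponential_prob_itv0c //.
case: (exponential_prob r (~` _)) => [x| |] //.
rewrite -EFinB -EFinD => -[] H; congr EFin.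
have -> : - t * r = - r * t by rewrite !mulNr mulrC.
lra.
Qed.

End exponential_tail.

Section law_expectation.
Context {R : realType} {d : nat}.
Local Notation Vec := 'rV[R]_d.
Local Notation Cvec := 'rV[R[i]]_d.
Local Notation FamT := (g_sigma_algebraType (@family_cylinders R d)).
Variables (h : Vec -> R) (dO : measure_display) (O : Vec -> measurableType dO).
Variable P : forall xi, probability (O xi) R.
Variables (W : forall xi, vertex -> O xi -> Vec)
  (T : forall xi, vertex -> O xi -> R) (K : forall xi, vertex -> O xi -> bool).
Hypothesis HC : cascade h P W T K.
Variables (chi0 : Vec -> Cvec) (mchi0 : measurable_cvec_fun chi0).

Definition truncated_mean n (eta : Vec) (r : R) : Cvec :=
  cvec_integral (law HC eta) setT (fun x => truncated chi0 n x r).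

Definition limit_mean_norm (eta : Vec) (r : R) : \bar R :=
  (\int[law HC eta]_x (cnorm (limit_value chi0 x r))%:E)%E.

Lemma cnorm_truncated_le n x r :
  cnorm (truncated chi0 n x r) <= cnorm (limit_value chi0 x r).
Proof.
by rewrite truncated_limit_valueE; case: ifP => // _; rewrite cnorm0 cnorm_ge0.
Qed.

Lemma truncated_mean_norm_lty n eta r : (limit_mean_norm eta r < +oo)%E ->
  (\int[law HC eta]_x (cnorm (truncated chi0 n x r))%:E < +oo)%E.
Proof.
apply: le_lt_trans; apply: ge0_le_integral => //.
- by move=> x _; rewrite lee_fin cnorm_ge0.
- by apply/measurable_EFinP; apply: measurable_cnorm; exact: measurable_truncated_at.
- by apply/measurable_EFinP; apply: measurable_cnorm; exact: measurable_limit_value.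
- by move=> x _; rewrite lee_fin cnorm_truncated_le.
Qed.

Lemma integral_law_signed eta (v : FamT -> \bar R) : eta != 0 ->
  measurable_fun setT v ->
  (\int[law HC eta]_x v x = \int[P eta]_omega v (branch W T [::] omega))%E.
Proof.
move=> eta0 mv; rewrite integralE [RHS]integralE; congr (_ - _)%E.
- rewrite (integral_law HC eta0) //; last exact: measurable_funepos.
  by apply: eq_integral => omega _; rewrite !funeposE.
- rewrite (integral_law HC eta0) //; last exact: measurable_funeneg.
  by apply: eq_integral => omega _; rewrite !funenegE.
Qed.

End law_expectation.

Section picard_step.
Context {R : realType} {d : nat}.
Local Notation Vec := 'rV[R]_d.
Local Notation Cvec := 'rV[R[i]]_d.
Local Notation FamT := (g_sigma_algebraType (@family_cylinders R d)).
Variables (d_gt0 : (0 < d)%N).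
Variables (h : Vec -> R) (hh : majorizing_kernel h).
Variables (dO : measure_display) (O : Vec -> measurableType dO).
Variable P : forall xi, probability (O xi) R.
Variables (W : forall xi, vertex -> O xi -> Vec)
  (T : forall xi, vertex -> O xi -> R) (K : forall xi, vertex -> O xi -> bool).
Hypothesis HC : cascade h P W T K.
Variables (chi0 : Vec -> Cvec) (mchi0 : measurable_cvec_fun chi0).
Variables (xi : Vec) (xi0 : xi != 0) (t : R) (t0 : 0 < t) (n : nat).
Variable k : 'I_d * bool.
Local Notation leb := (@lebesgue_measure R).
Local Notation leb_d := (lebesgue_rV d).
Local Notation rate := (enorm xi ^+ 2).
Local Notation dens := (offspring_density h xi).
Local Notation child_law eta := (law HC eta \x law HC (xi - eta))%E.
Local Notation weight := (first_branching_weight h xi).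
Local Notation history := (branch W T (xi:=xi) [::] : O xi -> FamT).

Let children (omega : O xi) : R * (FamT * FamT) :=
  (T [::] omega, (branch W T [:: false] omega, branch W T [:: true] omega)).

Let measurable_children : measurable_fun setT children.
Proof.
apply: measurable_fun_pair; first exact: (cascade_measurable_T HC).
by apply: measurable_fun_pair; exact: (measurable_branch HC xi0).
Qed.

Let g (z : R * (FamT * FamT)) : R :=
  if z.1 < t then
    real_coord k (odot xi (truncated chi0 n z.2.1 (t - z.1))
                          (truncated chi0 n z.2.2 (t - z.1)))
  else 0.

Let measurable_g : measurable_fun setT g.
Proof.
have mt : measurable_fun setT (fun z : R * (FamT * FamT) => t - z.1).
  by apply: measurable_funB => //; exact: measurable_fst.
have m2 : measurable_fun setT (fun z : R * (FamT * FamT) => z.2) by exact: measurable_snd.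
apply: measurable_fun_ifT.
- by apply: measurable_fun_ltr => //; exact: measurable_fst.
- apply: measurable_real_coord; apply: measurable_odot => //.
  + apply: (measurable_cvec_comp (theta := fun z : R * (FamT * FamT) => (z.2.1, t - z.1))
      _ (measurable_truncated n mchi0)).
    by apply: measurable_fun_pair => //; exact: (measurableT_comp measurable_fst m2).
  + apply: (measurable_cvec_comp (theta := fun z : R * (FamT * FamT) => (z.2.2, t - z.1))
      _ (measurable_truncated n mchi0)).
    by apply: measurable_fun_pair => //; exact: (measurableT_comp measurable_snd m2).
- exact: measurable_cst.
Qed.

Let stop_part (omega : O xi) : R :=
  \1_(`[t, +oo[%classic : set R) (T [::] omega) * real_coord k (chi0 xi).

Let first_step_ae : {ae P xi, forall omega,
  real_coord k (truncated chi0 n.+1 (history omega) t) =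
  stop_part omega + g (children omega)}.
Proof.
have := cascade_root HC xi0; apply: filterS => omega W0 /=.
rewrite /stop_part /g /= W0 indicE ltNge.
have [tT|Tt] := leP t (T [::] omega) => /=.
  by rewrite mem_set ?mul1r ?addr0 //= in_itv /= andbT.
by rewrite memNset ?mul0r ?add0r //= in_itv /= andbT => /(lt_le_trans Tt); rewrite ltxx.
Qed.

Hypothesis finite_mean : (limit_mean_norm HC chi0 xi t < +oo)%E.

(** The branching part is either 0 or the cut-off value itself, and is therefore
    dominated by the norm of the minimal process; the norms of the two factors do
    not have to be controlled separately. *)
Let integrable_step :
  (P xi).-integrable setT (fun omega => (g (children omega))%:E).
Proof.
apply/integrableP; split.
  by apply/measurable_EFinP; exact: (measurableT_comp measurable_g measurable_children).
apply: (@le_lt_trans _ _ (\int[P xi]_omega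
    (cnorm (truncated chi0 n.+1 (history omega) t))%:E)%E); last first.
  have := truncated_mean_norm_lty mchi0 n.+1 finite_mean.
  rewrite (integral_law HC xi0) // => [x|]; first by rewrite lee_fin cnorm_ge0.
  by apply/measurable_EFinP; apply: measurable_cnorm; exact: measurable_truncated_at.
apply: le_integral_ae_ge0 => //.
  by move=> omega _; rewrite lee_fin cnorm_ge0.
have := first_step_ae; apply: filterS => omega E _.
rewrite /= lee_fin; apply: le_trans (real_coord_le_cnorm k _); rewrite E.
rewrite /stop_part /g /= indicE.
case: ltP => [Tt|_]; last by rewrite normr0.
by rewrite memNset ?mul0r ?add0r //= in_itv /= andbT => /(lt_le_trans Tt); rewrite ltxx.
Qed.

Let truncated_mean_split :
  real_coord k (truncated_mean HC chi0 n.+1 xi t) =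
  expR (- t * rate) * real_coord k (chi0 xi) +
  fine (\int[P xi]_omega (g (children omega))%:E)%E.
Proof.
have mT := cascade_measurable_T HC xi0 [::].
have mI : measurable (`[t, +oo[%classic : set R) by exact: measurable_itv.
have mTI : measurable (@T xi [::] @^-1` `[t, +oo[%classic).
  by have := mT measurableT _ mI; rewrite setTI.
rewrite real_coord_integral /Rintegral (integral_law_signed HC xi0); last first.
  by apply/measurable_EFinP; apply: measurable_real_coord; exact: measurable_truncated_at.
transitivity (fine (\int[P xi]_omega ((stop_part omega)%:E + (g (children omega))%:E))%E).
  congr fine; apply: ae_eq_integral_nonmeasurable => //.
  by have := first_step_ae; apply: filterS => omega ->.
have indE : (\int[P xi]_omega (\1_(`[t, +oo[%classic : set R) (T [::] omega))%:E =
    (expR (- t * rate))%:E)%E.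
  rewrite -(exponential_prob_itvcy (rate_gt0 xi0) t0).
  transitivity (P xi (@T xi [::] @^-1` `[t, +oo[%classic)).
    rewrite -[X in P xi X]setIT -integral_indic //.
  have := root_offspring d_gt0 HC xi0 mI measurableT.
  rewrite (integral_offspring_density d_gt0 HC xi0) mule1 => <-; congr (P xi _).
  by apply/seteqP; split => omega /=; [|case].
have istop : (P xi).-integrable setT
    (fun omega => (\1_(`[t, +oo[%classic : set R) (T [::] omega))%:E).
  exact: (integrable_indic (P xi) mTI).
have istop' : (P xi).-integrable setT (fun omega => (stop_part omega)%:E).
  rewrite /stop_part; under eq_fun do rewrite mulrC EFinM.
  exact: integrableZl.
rewrite integralD // fineD.
- congr (_ + _); rewrite /stop_part.
  under eq_integral do rewrite mulrC EFinM.
  by rewrite integralZl // indE /= mulrC.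
- exact: (integrable_fin_num measurableT istop').
- exact: (integrable_fin_num measurableT integrable_step).
Qed.

Hypothesis induction_ae : {ae leb, forall s, 0 <= s -> s < t ->
  {ae leb_d, forall eta, [/\ (limit_mean_norm HC chi0 eta (t - s) < +oo)%E,
    (limit_mean_norm HC chi0 (xi - eta) (t - s) < +oo)%E,
    picard h chi0 n eta (t - s) = truncated_mean HC chi0 n eta (t - s) &
    picard h chi0 n (xi - eta) (t - s) =
      truncated_mean HC chi0 n (xi - eta) (t - s)]}}.

Let gE z := (g z)%:E.
Let Jp (q : R * Vec) := (\int[child_law q.2]_p (gE^\+ (q.1, p)))%E.
Let Jm (q : R * Vec) := (\int[child_law q.2]_p (gE^\- (q.1, p)))%E.

Let measurable_gE : measurable_fun setT gE.
Proof. by apply/measurable_EFinP; exact: measurable_g. Qed.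

Let integral_positive_part :
  (\int[leb \x leb_d]_q ((weight q)%:E * Jp q) =
   \int[P xi]_omega (fun omega => (g (children omega))%:E)^\+ omega)%E.
Proof.
rewrite -(first_branching_integral d_gt0 hh HC xi0 (f := gE^\+%E)) //.
- by apply: eq_integral => omega _; rewrite !funeposE.
- exact: measurable_funepos.
Qed.

Let integral_negative_part :
  (\int[leb \x leb_d]_q ((weight q)%:E * Jm q) =
   \int[P xi]_omega (fun omega => (g (children omega))%:E)^\- omega)%E.
Proof.
rewrite -(first_branching_integral d_gt0 hh HC xi0 (f := gE^\-%E)) //.
- by apply: eq_integral => omega _; rewrite !funenegE.
- exact: measurable_funeneg.
Qed.

Let measurable_weighted (v : R * (FamT * FamT) -> \bar R) :
  (forall z, 0 <= v z)%E -> measurable_fun setT v ->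
  measurable_fun setT (fun q : measurableTypeR R * Vec =>
    (weight q)%:E * \int[child_law q.2]_p v (q.1, p))%E.
Proof.
move=> v0 mv; apply: emeasurable_funM.
  by apply/measurable_EFinP; exact: (measurable_first_branching_weight hh xi).
exact: measurable_integral_child_law.
Qed.

Let integrable_weighted (v : R * (FamT * FamT) -> \bar R) :
  (forall z, 0 <= v z)%E -> measurable_fun setT v ->
  (\int[leb \x leb_d]_q ((weight q)%:E * \int[child_law q.2]_p v (q.1, p)) < +oo)%E ->
  (leb \x leb_d)%E.-integrable setT (fun q : measurableTypeR R * Vec =>
    (weight q)%:E * \int[child_law q.2]_p v (q.1, p))%E.
Proof.
move=> v0 mv voo; apply/integrableP; split; first exact: measurable_weighted.
under eq_integral do rewrite gee0_abs ?mule_ge0 ?lee_fin ?first_branching_weight_ge0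
  ?integral_ge0 //.
exact: voo.
Qed.

Let G (q : measurableTypeR R * Vec) : \bar R :=
  ((weight q)%:E * Jp q - (weight q)%:E * Jm q)%E.

Let ip : (leb \x leb_d)%E.-integrable setT (fun q : measurableTypeR R * Vec => (weight q)%:E * Jp q)%E.
Proof.
apply: integrable_weighted => //; first exact: measurable_funepos.
rewrite [ltLHS]integral_positive_part.
exact: (integral_funepos_lt_pinfty measurableT integrable_step).
Qed.

Let im : (leb \x leb_d)%E.-integrable setT (fun q : measurableTypeR R * Vec => (weight q)%:E * Jm q)%E.
Proof.
apply: integrable_weighted => //; first exact: measurable_funeneg.
rewrite [ltLHS]integral_negative_part.
exact: (integral_funeneg_lt_pinfty measurableT integrable_step).
Qed.

Let iG : (leb \x leb_d)%E.-integrable setT G.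
Proof. exact: (integrableB measurableT ip im). Qed.

Let integral_G : (\int[leb]_s \int[leb_d]_eta G (s, eta) =
  \int[P xi]_omega (g (children omega))%:E)%E.
Proof.
rewrite (integral12_prod_meas1 iG) (integralB measurableT ip im).
by rewrite integral_positive_part integral_negative_part -integralE.
Qed.

Let phi (s : R) : R := expR (- s * rate) * rate *
  \int[leb_d]_eta (branching_density h eta xi *
    real_coord k (odot xi (picard h chi0 n eta (t - s)) (picard h chi0 n (xi - eta) (t - s)))).

Let G_outside s eta : ~ `[0, t]%classic s -> G (s, eta) = 0%E.
Proof.
rewrite /= in_itv /= => /negP; rewrite negb_and -!ltNge => /orP[s0|ts].
  by rewrite /G /first_branching_weight /= lt0_exponential_pdf // !mul0r !mul0e sube0.
have g0 p : gE (s, p) = 0%E by rewrite /gE /g /= ltNge (ltW ts).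
rewrite /G /Jp /Jm; under eq_integral do rewrite funeposE g0 maxxx.
by under [X in (_ - _ * X)%E]eq_integral do rewrite funenegE g0 oppe0 maxxx;
  rewrite !integral0 !mule0 sube0.
Qed.

(** The identity on which the step rests: given the first branching, the mean of the
    product is the product of the means. *)
Let G_inside s eta : 0 <= s -> s < t ->
  (limit_mean_norm HC chi0 eta (t - s) < +oo)%E ->
  (limit_mean_norm HC chi0 (xi - eta) (t - s) < +oo)%E ->
  G (s, eta) = (expR (- s * rate) * rate * (dens eta *
    real_coord k (odot xi (truncated_mean HC chi0 n eta (t - s))
                          (truncated_mean HC chi0 n (xi - eta) (t - s)))))%:E.
Proof.
move=> s0 st H1 H2.
have [] := integral_odot xi k (measurable_truncated_at mchi0 n (t - s))
  (measurable_truncated_at mchi0 n (t - s))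
  (truncated_mean_norm_lty mchi0 n H1) (truncated_mean_norm_lty mchi0 n H2).
set v := (fun p : FamT * FamT => _) => iv Ev.
have vE p : gE (s, p) = v p by rewrite /gE /g /= st.
have -> : G (s, eta) = ((weight (s, eta))%:E * \int[child_law eta]_p v^\+ p -
    (weight (s, eta))%:E * \int[child_law eta]_p v^\- p)%E.
  rewrite /G /Jp /Jm /=; congr (_ * _ - _ * _)%E; apply: eq_integral => p _.
    by rewrite !funeposE vE.
  by rewrite !funenegE vE.
rewrite -muleBr //; last first.
  rewrite fin_num_adde_defr //; exact: (integrable_pos_fin_num measurableT iv).
rewrite -integralE Ev -EFinM; congr EFin.
rewrite /first_branching_weight /=.
have -> : exponential_pdf rate s = expR (- s * rate) * rate.
  by rewrite exponential_pdfE // mulrC !mulNr (mulrC s).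
by rewrite -!mulrA.
Qed.

Let inner_ae : {ae leb, forall s,
  (\int[leb_d]_eta G (s, eta))%E = ((EFin \o phi) \_ `[0, t]) s}.
Proof.
have Gs := ae_integrable1 iG.
have nt : {ae leb, forall s : R, s != t}.
  exists [set t]; split => //; first exact: lebesgue_measure_set1.
  by move=> x /= /negP/negPn/eqP.
have Flt : Filter (nbhs (almost_everywhere leb)) by exact: ae_filter_ringOfSetsType.
have H3 := @filterI _ _ Flt _ _ induction_ae (@filterI _ _ Flt _ _ Gs nt).
apply: (@filterS _ _ Flt _ _ _ H3) => s [Hs [iGs st]].
rewrite patchE; case: ifPn; last first.
  rewrite notin_setE => sN; rewrite integral0_eq // => eta _; exact: G_outside.
rewrite inE /= in_itv /= => /andP[s0 slet].
have {slet}slt : s < t by rewrite lt_neqAle st.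
have {}Hs := Hs s0 slt.
set rho := expR (- s * rate) * rate.
have rho0 : rho != 0 by rewrite mulf_neq0 ?gt_eqF ?expR_gt0 ?rate_gt0.
have fG : (\int[leb_d]_eta G (s, eta))%E \is a fin_num.
  exact: (integrable_fin_num measurableT iGs).
rewrite /= /phi -/rho.
(* Dividing G by rho takes the time density out of the integral over eta while
   keeping a measurable integrand, which the Picard iterates do not provide. *)
have -> : \int[leb_d]_eta (branching_density h eta xi * real_coord k
    (odot xi (picard h chi0 n eta (t - s)) (picard h chi0 n (xi - eta) (t - s)))) =
    fine (\int[leb_d]_eta ((rho^-1)%:E * G (s, eta)))%E.
  rewrite /Rintegral; congr fine; apply: ae_eq_integral_nonmeasurable => //.
  move: Hs (offspring_density_ae d_gt0 h xi0); apply: filterS2 => eta [H1 H2 E1 E2] Ed _.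
  rewrite (G_inside s0 slt H1 H2) -/rho -EFinM (mulKf rho0) E1 E2.
  by congr (EFin (_ * _)).
rewrite (integralZl measurableT iGs) fineM; [|by []|exact: fG].
by rewrite mulrA (divff rho0) mul1r (fineK fG).
Qed.

Lemma picard_step :
  real_coord k (picard h chi0 n.+1 xi t) =
  real_coord k (truncated_mean HC chi0 n.+1 xi t).
Proof.
rewrite truncated_mean_split [picard _ _ _ _ _]/= real_coordD real_coordZ.
congr (_ + _); rewrite -integral_G.
transitivity (fine (\int[leb]_(s in `[0%R, t]) (phi s)%:E)%E).
  rewrite /duhamel real_coord_integral /Rintegral; congr fine.
  apply: eq_integral => s _; rewrite real_coordZ real_coord_integral; congr (_ * _)%:E.
  by apply: eq_Rintegral => eta _; rewrite real_coordZ.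
congr fine; rewrite integral_mkcond; apply: ae_eq_integral_nonmeasurable => //.
by move: inner_ae; apply: filterS => s ->.
Qed.

End picard_step.

(** * Convergence of the Picard iteration *)

Section product_null_sets.
Local Open Scope ereal_scope.
Context dT (S : measurableType dT) dT' (S' : measurableType dT') (R : realType).
Variables (m1 : {sigma_finite_measure set S -> \bar R})
  (m2 : {sigma_finite_measure set S' -> \bar R}).

Lemma ae_product_fst (Q : S -> Prop) : {ae m1, forall x, Q x} ->
  {ae m1 \x m2, forall p, Q p.1}.
Proof.
move=> [N [mN N0 HN]]; exists (N `*` setT); split.
- exact: measurableX.
- by rewrite product_measure1E // [X in X * _]N0 mul0e.
- by move=> p /= nQ; split => //; exact: HN.
Qed.

Lemma ae_product_snd (Q : S' -> Prop) : {ae m2, forall y, Q y} ->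
  {ae m1 \x m2, forall p, Q p.2}.
Proof.
move=> [N [mN N0 HN]]; exists (setT `*` N); split.
- exact: measurableX.
- by rewrite product_measure1E // [X in _ * X]N0 mule0.
- by move=> p /= nQ; split => //; exact: HN.
Qed.

End product_null_sets.

Section convergence.
Context {R : realType} {d : nat}.
Local Notation Vec := 'rV[R]_d.
Local Notation Cvec := 'rV[R[i]]_d.
Local Notation FamT := (g_sigma_algebraType (@family_cylinders R d)).
Variables (d_gt0 : (0 < d)%N).
Variables (h : Vec -> R) (hh : majorizing_kernel h).
Variables (dO : measure_display) (O : Vec -> measurableType dO).
Variable P : forall xi, probability (O xi) R.
Variables (W : forall xi, vertex -> O xi -> Vec)
  (T : forall xi, vertex -> O xi -> R) (K : forall xi, vertex -> O xi -> bool).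
Hypothesis HC : cascade h P W T K.
Variables (chi0 : Vec -> Cvec) (mchi0 : measurable_cvec_fun chi0).
Local Notation leb := (@lebesgue_measure R).
Local Notation leb_d := (lebesgue_rV d).
Local Notation minimal := (minimal_cascade W T chi0).

Lemma mean_norm_minimal eta r : eta != 0 ->
  mean_norm P minimal eta r = limit_mean_norm HC chi0 eta r.
Proof.
move=> eta0; rewrite /limit_mean_norm (integral_law HC eta0); last 2 first.
- by move=> x; rewrite lee_fin cnorm_ge0.
- by apply/measurable_EFinP; apply: measurable_cnorm; exact: measurable_limit_value.
apply: ae_eq_integral_nonmeasurable => //.
by have := minimal_cascade_ae HC eta0 chi0 r; apply: filterS => omega ->.
Qed.

Lemma mean_minimal eta r : eta != 0 ->
  mean P minimal eta r = cvec_integral (law HC eta) setT (fun x => limit_value chi0 x r).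
Proof.
move=> eta0; apply: eq_real_coord => k; rewrite !real_coord_integral /Rintegral.
congr fine; rewrite (integral_law_signed HC eta0); last first.
  by apply/measurable_EFinP; apply: measurable_real_coord; exact: measurable_limit_value.
apply: ae_eq_integral_nonmeasurable => //.
by have := minimal_cascade_ae HC eta0 chi0 r; apply: filterS => omega ->.
Qed.

Variable Tmax : \bar R.
Hypothesis finite_ae :
  ae_before Tmax (fun xi t => xi != 0 -> (limit_mean_norm HC chi0 xi t < +oo)%E).

(** The induction hypothesis holds almost everywhere before Tmax; sections of null
    sets and their images under the two reflections are null, so it holds at
    (eta, t - s) and (xi - eta, t - s) for almost every s and eta. *)
Lemma picard_truncated_mean n xi t : xi != 0 -> 0 < t -> (t%:E < Tmax)%E ->
  (limit_mean_norm HC chi0 xi t < +oo)%E ->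
  picard h chi0 n xi t = truncated_mean HC chi0 n xi t.
Proof.
elim: n xi t => [|n IH] xi t xi0 t0 tT fin.
  apply: eq_real_coord => k; rewrite real_coord_integral real_coord0.
  by rewrite /Rintegral integral0_eq // => x _; rewrite /= real_coord0.
apply: eq_real_coord => k; apply: picard_step => //.
have mrefl : measurable_fun [set: measurableTypeR R]
    (fun s : measurableTypeR R => t - s : measurableTypeR R).
  exact: measurable_funB.
have sections := ae_comp mrefl (@lebesgue_measure_reflect R t) (ae_product_section finite_ae).
have Flt : Filter (nbhs (almost_everywhere leb)) by exact: ae_filter_ringOfSetsType.
apply: (@filterS _ _ Flt _ _ _ sections) => s Hs s0 st.
have Hs' := ae_comp (measurable_rV_reflect xi) (@lebesgue_rV_reflect R d xi) Hs.
have ts0 : 0 < t - s by rewrite subr_gt0.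
have tsT : ((t - s)%:E < Tmax)%E.
  by apply: le_lt_trans tT; rewrite lee_fin gerBl.
have H0xi : {ae leb_d, forall eta, eta != 0 /\ eta != xi}.
  have H0 := ae_neq d_gt0 (0 : Vec); have Hxi := ae_neq d_gt0 xi.
  by move: H0 Hxi; apply: filterS2 => eta ? ?; split.
move: Hs Hs' H0xi; apply: filterS3 => eta H1 H2 [eta0 etaxi].
have etaxi0 : xi - eta != 0 by rewrite subr_eq0 eq_sym.
have F1 := H1 (ltW ts0) tsT eta0; have F2 := H2 (ltW ts0) tsT etaxi0.
by split => //; exact: IH.
Qed.

Lemma truncated_mean_cvg xi t k : xi != 0 ->
  (limit_mean_norm HC chi0 xi t < +oo)%E ->
  real_coord k (truncated_mean HC chi0 n xi t) @[n --> \oo] -->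
  real_coord k (mean P minimal xi t).
Proof.
move=> xi0 fin; rewrite (mean_minimal _ xi0).
under eq_fun do rewrite real_coord_integral.
rewrite real_coord_integral /Rintegral.
have mlim := measurable_limit_value mchi0 t.
have ilim := integrable_real_coord k mlim fin.
apply: fine_cvg; rewrite fineK; last exact: (integrable_fin_num measurableT ilim).
have icnorm : (law HC xi).-integrable setT (fun x => (cnorm (limit_value chi0 x t))%:E).
  apply/integrableP; split; first by apply/measurable_EFinP; exact: measurable_cnorm.
  by under eq_integral do rewrite gee0_abs ?lee_fin ?cnorm_ge0 //.
apply: (@dominated_cvg _ _ _ (law HC xi) setT measurableT
  (fun n x => (real_coord k (truncated chi0 n x t))%:E)
  (fun x => (real_coord k (limit_value chi0 x t))%:E)
  (fun x => (cnorm (limit_value chi0 x t))%:E)) => //.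
- by move=> n; apply/measurable_EFinP; apply: measurable_real_coord; exact: measurable_truncated_at.
- move=> x _; apply: cvg_near_cst.
  by have := truncated_near_limit_value chi0 x t; apply: filterS => n ->.
- move=> n x _; rewrite lee_fin; apply: le_trans (real_coord_le_cnorm _ _) _.
  exact: cnorm_truncated_le.
Qed.

Lemma cnorm_cvg0 (a : nat -> Cvec) (b : Cvec) :
  (forall k, real_coord k (a n) @[n --> \oo] --> real_coord k b) ->
  cnorm (a n - b) @[n --> \oo] --> (0 : R).
Proof.
move=> ab.
have -> : (fun n => cnorm (a n - b)) =
    (fun n => Num.sqrt (\sum_k (real_coord k (a n) - real_coord k b) ^+ 2)).
  by apply/funext => n; rewrite cnormE; under eq_bigr do rewrite real_coordB.
rewrite -[X in _ --> X](sqrtr0 R).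
apply: continuous_cvg; first exact: sqrt_continuous.
have sq k : (real_coord k (a n) - real_coord k b) ^+ 2 @[n --> \oo] --> (0 : R).
  have sub : real_coord k (a n) - real_coord k b @[n --> \oo] --> (0 : R).
    by have := cvgB (ab k) (cvg_cst (real_coord k b)); rewrite subrr; exact.
  by have := cvgM sub sub; rewrite mulr0; exact.
elim: (index_enum _) => [|k ks IH].
  by under eq_fun do rewrite big_nil; exact: cvg_cst.
under eq_fun do rewrite big_cons.
by have := cvgD (sq k) IH; rewrite addr0; exact.
Qed.

Lemma picard_cvg xi t : xi != 0 -> 0 < t -> (t%:E < Tmax)%E ->
  (limit_mean_norm HC chi0 xi t < +oo)%E ->
  cnorm (picard h chi0 n xi t - mean P minimal xi t) @[n --> \oo] --> (0 : R).
Proof.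
move=> xi0 t0 tT fin; apply: cnorm_cvg0 => k.
under eq_fun do rewrite picard_truncated_mean //.
exact: truncated_mean_cvg.
Qed.

End convergence.

Theorem theorem2p4 (R : realType) (d : nat) (hd : (3 <= d)%N)
    (h : 'rV[R]_d -> R) (hh : majorizing_kernel h)
    (dO : measure_display) (O : 'rV[R]_d -> measurableType dO)
    (P : forall xi, probability (O xi) R)
    (W : forall xi, vertex -> O xi -> 'rV[R]_d)
    (T : forall xi, vertex -> O xi -> R)
    (K : forall xi, vertex -> O xi -> bool)
    (hWTK : cascade h P W T K)
    (chi0 : 'rV[R]_d -> 'rV[R[i]]_d) (mchi0 : measurable_cvec_fun chi0)
    (Tmax : \bar R) (hTmax : (0 <= Tmax)%E) :
  let Xbar := thinned_cascade W T K chi0 in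
  let Xmin := minimal_cascade W T chi0 in
  (ae_before Tmax (fun xi t => mean_norm P Xbar xi t < +oo)%E ->
   ae_before Tmax (fun xi t =>
     cnorm (picard h chi0 n xi t - mean P Xbar xi t) @[n --> \oo] --> (0 : R)))
  /\
  (ae_before Tmax (fun xi t => mean_norm P Xbar xi t < +oo)%E ->
   ae_before Tmax (fun xi t =>
     cnorm (picard h chi0 n xi t - mean P Xmin xi t) @[n --> \oo] --> (0 : R)))
  /\
  ae_before +oo%E (fun xi t => mean_norm P Xbar xi t = mean_norm P Xmin xi t)
  /\
  (ae_before Tmax (fun xi t => mean_norm P Xbar xi t < +oo)%E \/
   ae_before Tmax (fun xi t => mean_norm P Xmin xi t < +oo)%E ->
   ae_before Tmax (fun xi t => mean P Xbar xi t = mean P Xmin xi t)).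
Proof.
move=> Xbar Xmin.
have d_gt0 : (0 < d)%N by apply: leq_trans hd.
have xi_neq0 : {ae (lebesgue_rV d \x @lebesgue_measure R)%E,
    forall p : 'rV[R]_d * R, p.1 != 0}.
  exact: (ae_product_fst _ (ae_neq d_gt0 0)).
have t_neq0 : {ae (lebesgue_rV d \x @lebesgue_measure R)%E,
    forall p : 'rV[R]_d * R, p.2 != 0}.
  have nonzero : {ae @lebesgue_measure R, forall s : measurableTypeR R, s != 0}.
    exists [set 0]; split => //; first exact: lebesgue_measure_set1.
    by move=> x /= /negP/negPn/eqP.
  exact: (ae_product_snd (lebesgue_rV d) nonzero).
have aeS := @filterS _ _ (ae_filter_ringOfSetsType (lebesgue_rV d \x @lebesgue_measure R)%E).
have aeI := @filterI _ _ (ae_filter_ringOfSetsType (lebesgue_rV d \x @lebesgue_measure R)%E).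
have means_eq Tm : ae_before Tm (fun xi t => mean P Xbar xi t = mean P Xmin xi t).
  apply: (aeS _ _ _ xi_neq0) => -[xi t] /= xi0 _ _; exact: (mean_thinned_minimal hWTK xi0 mchi0).
have min_cvg : ae_before Tmax (fun xi t => mean_norm P Xbar xi t < +oo)%E ->
   ae_before Tmax (fun xi t =>
     cnorm (picard h chi0 n xi t - mean P Xmin xi t) @[n --> \oo] --> (0 : R)).
  move=> fin.
  have finite_ae : ae_before Tmax (fun xi t => xi != 0 ->
      (limit_mean_norm hWTK chi0 xi t < +oo)%E).
    apply: (aeS _ _ _ fin) => -[xi t] /= H t0 tT xi0.
    rewrite -mean_norm_minimal // -(mean_norm_thinned_minimal hWTK xi0 mchi0).
    exact: H.
  apply: (aeS _ _ _ (aeI _ _ finite_ae (aeI _ _ xi_neq0 t_neq0))).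
  move=> -[xi t] /= [H [xi0 t0]] tge0 tT.
  apply: (picard_cvg d_gt0 hh mchi0 finite_ae) => //.
  - by rewrite lt_neqAle eq_sym t0.
  - exact: H.
split; last split; last split.
- move=> fin; apply: (aeS _ _ _ (aeI _ _ (min_cvg fin) (means_eq Tmax))).
  by move=> -[xi t] /= [H E] t0 tT; rewrite E //; exact: H.
- exact: min_cvg.
- apply: (aeS _ _ _ xi_neq0) => -[xi t] /= xi0 _ _.
  exact: (mean_norm_thinned_minimal hWTK xi0 mchi0).
- by move=> _; exact: means_eq.
Qed.
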